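(* Let $U$ and $V$ be real Hilbert spaces, $F\colon U\to V$ a bounded linear operator, and $\mathcal{R}\colon U\to[0,+\infty]$ a convex, lower semi-continuous and coercive functional. Let $v^\dagger\in V$ and let $u^\dagger\in\operatorname{arg\,min}_u\{\mathcal{R}(u): Fu=v^\dagger\}$. Assume that $\mathcal{R}$ is locally $q$-coconvex for some $1\le q<+\infty$ and that for some $1/2<\nu\le1$ there exist $\eta^\dagger\in U$ and $$\xi^\dagger:=(F^*F)^\nu\eta^\dagger\in\partial\mathcal{R}(u^\dagger).$$ For a minimiser $u_\alpha^\delta$ of $\mathcal{T}_\alpha(u,v^\delta)=\frac12\lVert Fu-v^\delta\rVert^2+\alpha\mathcal{R}(u)$ put $\xi_\alpha^\delta:=\frac1\alpha F^*(v^\delta-Fu_\alpha^\delta)\in\partial\mathcal{R}(u_\alpha^\delta)$. Then for every $M>0$ there exist constants $C_1,C_2>0$ such that $$\mathcal{D}^{\mathrm{sym}}_{\xi_\alpha^\delta,\xi^\dagger}(u_\alpha^\delta,u^\dagger)\le C_1\frac{\delta^2}{\alpha}+C_2\alpha^{\frac{q\nu}{1+\nu q-2\nu}}$$ for all $\delta,\alpha>0$ with $\delta^2/\alpha\le M$, all $v^\delta\in V$ with $\lVert v^\delta-v^\dagger\rVert\le\delta$, and all minimisers $u_\alpha^\delta$ of $\mathcal{T}_\alpha(\cdot,v^\delta)$. In particular, with $a:=\frac{2+2\nu q-4\nu}{1+2\nu q-2\nu}$ and a parameter choice $\alpha\sim\delta^{a}$ one obtains the convergence rate $\mathcal{D}^{\mathrm{sym}}_{\xi_\alpha^\delta,\xi^\dagger}(u_\alpha^\delta,u^\dagger)\lesssim\delta^{\frac{2\nu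 q}{1+2\nu q-2\nu}}$ as $\delta\to0$; that is, for all $0<c\le c'$ there exist $\delta_0>0$ and $C>0$ such that $\mathcal{D}^{\mathrm{sym}}_{\xi_\alpha^\delta,\xi^\dagger}(u_\alpha^\delta,u^\dagger)\le C\delta^{\frac{2\nu q}{1+2\nu q-2\nu}}$ for all $0<\delta\le\delta_0$, all $\alpha$ with $c\,\delta^{a}\le\alpha\le c'\delta^{a}$, all $v^\delta\in V$ with $\lVert v^\delta-v^\dagger\rVert\le\delta$, and all minimisers $u_\alpha^\delta$ of $\mathcal{T}_\alpha(\cdot,v^\delta)$.
   Context: Coercive means $\mathcal{R}(u)\to+\infty$ as $\lVert u\rVert\to\infty$. The subdifferential $\partial\mathcal{R}(u)$ is the set of $\xi\in U$ with $\mathcal{R}(u)<\infty$ and $\mathcal{R}(w)\ge\mathcal{R}(u)+\langle\xi,w-u\rangle$ for all $w\in U$; $\operatorname{dom}\partial\mathcal{R}=\{u:\partial\mathcal{R}(u)\ne\emptyset\}$. Fractional powers $(F^*F)^\nu$ are defined by the spectral calculus. For $\xi_1\in\partial\mathcal{R}(u_1)$ and $\xi_2\in\partial\mathcal{R}(u_2)$ the symmetric Bregman distance is $\mathcal{D}^{\mathrm{sym}}_{\xi_1,\xi_2}(u_1,u_2)=\langle\xi_1-\xi_2,u_1-u_2\rangle$. The first order optimality condition for $u_\alpha^\delta$ says precisely that $\frac1\alpha F^*(v^\delta-Fu_\alpha^\delta)\in\partial\mathcal{R}(u_\alpha^\delta)$. Locally $q$-coconvex ($1\le q<\infty$): for every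 $\rho>0$ there is a constant $C=C(\rho)>0$ such that $C\lVert\xi_1-\xi_2\rVert^q\le\langle\xi_1-\xi_2,u_1-u_2\rangle$ for all $u_1,u_2\in\operatorname{dom}\partial\mathcal{R}$ with $\lVert u_i\rVert\le\rho$ and all $\xi_1\in\partial\mathcal{R}(u_1)$, $\xi_2\in\partial\mathcal{R}(u_2)$. The constants in the claim may depend on all fixed data ($F,\mathcal{R},u^\dagger,\xi^\dagger,\eta^\dagger,\nu,q$, and $M$, respectively $c,c'$) but not on $\delta$, $\alpha$, $v^\delta$ or the minimiser. *)

(* Defs.v *)
From HB Require Import structures.
From mathcomp Require Export all_boot all_order all_algebra.
From mathcomp Require Export all_classical all_reals all_analysis.
Export Order.TTheory GRing.Theory Num.Theory.
Export numFieldNormedType.Exports.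

Set Implicit Arguments.
Unset Strict Implicit.
Unset Printing Implicit Defensive.

Local Open Scope classical_set_scope.
Local Open Scope ring_scope.

(* Real Hilbert spaces: complete normed spaces whose norm comes from a
   symmetric positive definite bilinear form. *)
HB.mixin Record CompleteNormedModule_isHilbert (R : realType) U
    & CompleteNormedModule R U := {
  inner : {dot U for (@idfun R)} ;
  normr_sqrE : forall u : U, `|u| ^+ 2 = inner u u
}.

#[short(type="hilbertType")]
HB.structure Definition Hilbert (R : realType) :=
  {U of CompleteNormedModule_isHilbert R U & CompleteNormedModule R U}.

Notation "''[' u , v ]" := (inner u v)
  (at level 0, format "''[' u ,  v ]") : ring_scope.

Section Operators.
Context {R : realType}.

(* By the Riesz representation theorem there is exactly one such w when F is
   linear and bounded; the default value 0 is then never used. *)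
Definition adjoint (U V : hilbertType R) (F : U -> V) (v : V) : U :=
  xget 0 [set w | forall u, '[F u, v] = '[u, w]].

Context {U : hilbertType R}.

Definition horner_op (p : {poly R}) (A : U -> U) (x : U) : U :=
  \sum_(i < size p) p`_i *: iter i A x.

Definition spectrum (A : U -> U) : set R :=
  [set l | ~ exists B : U -> U,
    [/\ continuous B, cancel (fun x => A x - l *: x) B &
        cancel B (fun x => A x - l *: x)]].

(* Continuous functional calculus f(A) of a bounded self-adjoint operator A and
   a function f continuous on its spectrum: the limit in operator norm of p_n(A)
   for polynomials p_n converging to f uniformly on the spectrum of A.
   Such p_n exist (Weierstrass) and the limit exists and does not depend on
   them, because the operator norm of p(A) is the maximum of |p| on the
   spectrum. Hence the set below is a singleton, and the default value is
   not used. *)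
Definition spectral_calculus (A : U -> U) (f : R -> R) : U -> U :=
  xget (fun=> 0) [set B : U -> U | forall p : nat -> {poly R},
    {uniform spectrum A, (fun n t => (p n).[t]) @ \oo --> f} ->
    forall e : R, 0 < e ->
      \forall n \near \oo, forall x, `|horner_op (p n) A x - B x| <= e * `|x|].

Definition op_powR (A : U -> U) (nu : R) : U -> U :=
  spectral_calculus A (fun t => t `^ nu).

End Operators.

Section ConvexAnalysis.
Context {R : realType} {U : hilbertType R}.
Implicit Type J : U -> \bar R.
Local Open Scope ereal_scope.

(* At t = 0 and t = 1 the convention 0 * +oo = 0 makes this hold trivially. *)
Definition convex_functional J := forall (u w : U) (t : R), (0 <= t <= 1)%R ->
  J (t *: u + (1 - t) *: w)%R <= t%:E * J u + (1 - t)%:E * J w.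

Definition coercive J := forall a : R,
  exists r : R, forall u : U, (r <= `|u|)%R -> a%:E <= J u.

Definition argmin (D : set U) J : set U :=
  [set u | D u /\ forall w, D w -> J u <= J w].

Definition subdifferential J (u : U) : set U :=
  [set xi | J u < +oo /\ forall w, J u + '[xi, (w - u)%R]%:E <= J w].

Definition dom_subdifferential J : set U :=
  [set u | subdifferential J u !=set0].

Definition sym_bregman (xi1 xi2 u1 u2 : U) : R := '[xi1 - xi2, u1 - u2]%R.

Definition locally_coconvex (q : R) J := forall rho : R, (0 < rho)%R ->
  exists2 C : R, (0 < C)%R & forall u1 u2 xi1 xi2 : U,
    dom_subdifferential J u1 -> dom_subdifferential J u2 ->
    (`|u1| <= rho)%R -> (`|u2| <= rho)%R ->
    subdifferential J u1 xi1 -> subdifferential J u2 xi2 ->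
    (C * `|xi1 - xi2| `^ q <= '[xi1 - xi2, u1 - u2])%R.

End ConvexAnalysis.

Section Tikhonov.
Context {R : realType} {U V : hilbertType R}.

Definition tikhonov (F : U -> V) (J : U -> \bar R) (alpha : R) (v : V) (u : U)
    : \bar R :=
  ((2^-1 * `|F u - v| ^+ 2)%:E + alpha%:E * J u)%E.

Definition tikhonov_subgradient (F : U -> V) (alpha : R) (v : V) (u : U) : U :=
  alpha^-1 *: adjoint F (v - F u).

End Tikhonov.

(* Main.v *)
From HB Require Import structures.
From mathcomp Require Import ring lra.
Require Import Defs.

(** Write [p = (v - F u) / alpha], so that [F^* p] is the subgradient singled
out by the optimality condition at the minimiser [u], and let [D] be the
symmetric Bregman distance of [u] and [udag].

Suppose for a moment that [xidag = F^* pdag].  Since [F u - F udag] equals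
[(v - vdag) - alpha p], the distance [D = <p - pdag, F u - F udag>] satisfies
  [D + alpha |p - pdag|^2 <= delta |p - pdag| - alpha <p - pdag, pdag>].
The source condition makes [pdag] an element of the range of
[(F F^* )^(nu - 1/2)], hence by interpolation
  [|<w, pdag>| <= c |w|^(2 - 2 nu) |F^* w|^(2 nu - 1)].
For [w = p - pdag] the vector [F^* w] is the difference of the two
subgradients, and coconvexity bounds its norm by a multiple of [D^(1/q)].
With [E = D + alpha |w|^2] all terms can be absorbed:
  [E <= 2 delta^2 / alpha + K alpha^nu E^(1 - s)],
  [s = nu - (2 nu - 1) / q],
and either the first summand is at least [E / 2], which gives
[E <= 4 delta^2 / alpha], or [E^s] is bounded by a multiple of [alpha^nu]; the
exponent [nu / s] is the one claimed ([rate_absorb], [bregman_rate]).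

The element [pdag] is never constructed.  It is replaced by [F h], where
[F^* F h] is as close to [xidag] as desired and the interpolation inequality
holds with a constant that does not depend on [h]
([source_interpolation]); the proximity is chosen after [D], which may be
assumed positive.  The vectors [h] are binomial-weighted sums of Landweber
iterates of [etadag]: with [T = 1 - F^* F / L],
  [h = L^(nu - 1) \sum_(i < n) b_i T^i etadag],
where [b_i] are the Taylor coefficients of [(1 - x)^(nu - 1)].  The scalar
polynomials converge uniformly to [t^nu] on [[0, L]], which contains the
spectrum of [F^* F]; this identifies the limit of [F^* F h] as the vector
given by the functional calculus ([landweber_poly_cvg]).  The interpolation
inequality follows from the decay
[(n + 1) |T^n F^* w|^2 <= L |w|^2] of the Landweber iterates
([landweber_decay]) by splitting the sum at the index where this bound
becomes better than [|T^n F^* w| <= |F^* w|]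
([binom_sum_interpolation]).

For [q = nu = 1] the denominator of the rate exponent vanishes.  This case is
covered because local 1-coconvexity forces subgradients to be locally
constant, so that a coercive functional with this property lives on the
trivial space ([coconvex1_trivial]).

Adjoints, inverses of coercive operators and proximal points all come from
one minimisation principle, [strongly_convex_min]. *)

Set Implicit Arguments.
Unset Strict Implicit.
Unset Printing Implicit Defensive.

Local Open Scope classical_set_scope.
Local Open Scope ring_scope.

(** * Inner products *)

Section Inner.
Context {R : realType} {U : hilbertType R}.
Implicit Types u v w : U.

Lemma innerC u v : '[u, v] = '[v, u].
Proof.
by rewrite (hermC (inner : {dot U for (@idfun R)})) expr0 mul1r.
Qed.

Lemma innerDl u v w : '[u + v, w] = '[u, w] + '[v, w].
Proof. exact: linearDl. Qed.

Lemma innerDr u v w : '[u, v + w] = '[u, v] + '[u, w].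
Proof. exact: linearDr. Qed.

Lemma innerZl a u v : '[a *: u, v] = a * '[u, v].
Proof. exact: linearZl_LR. Qed.

Lemma innerZr a u v : '[u, a *: v] = a * '[u, v].
Proof. by rewrite innerC innerZl innerC. Qed.

Lemma innerNl u v : '[- u, v] = - '[u, v].
Proof. exact: linearNl. Qed.

Lemma innerNr u v : '[u, - v] = - '[u, v].
Proof. exact: linearNr. Qed.

Lemma inner0l u : '[0, u] = 0.
Proof. exact: linear0l. Qed.

Lemma inner0r u : '[u, 0] = 0.
Proof. exact: linear0r. Qed.

Lemma innerBl u v w : '[u - v, w] = '[u, w] - '[v, w].
Proof. by rewrite innerDl innerNl. Qed.

Lemma innerBr u v w : '[u, v - w] = '[u, v] - '[u, w].
Proof. by rewrite innerDr innerNr. Qed.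

Lemma innerxx u : '[u, u] = `|u| ^+ 2.
Proof. by rewrite normr_sqrE. Qed.

Lemma normD_sqr u v : `|u + v| ^+ 2 = `|u| ^+ 2 + 2 * '[u, v] + `|v| ^+ 2.
Proof.
rewrite -!innerxx innerDl !innerDr (innerC v u); ring.
Qed.

Lemma normB_sqr u v : `|u - v| ^+ 2 = `|u| ^+ 2 - 2 * '[u, v] + `|v| ^+ 2.
Proof. rewrite normD_sqr innerNr normrN; ring. Qed.

Lemma normZ_sqr a u : `|a *: u| ^+ 2 = a ^+ 2 * `|u| ^+ 2.
Proof. by rewrite normrZ exprMn real_normK ?num_real. Qed.

Lemma cauchy_schwarz u v : `|'[u, v]| <= `|u| * `|v|.
Proof.
have [->|v0] := eqVneq v 0; first by rewrite inner0r !normr0 mulr0.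
have nv : 0 < `|v| by rewrite normr_gt0.
rewrite -(@ler_pXn2r _ 2) ?nnegrE ?mulr_ge0// real_normK ?num_real// exprMn.
have nv2 : 0 < `|v| ^+ 2 by rewrite exprn_gt0.
have := sqr_ge0 `|(`|v| ^+ 2) *: u - '[u, v] *: v|.
rewrite normB_sqr !normZ_sqr innerZl innerZr.
move=> H; rewrite -subr_ge0 -(pmulr_rge0 _ nv2); lra.
Qed.

Lemma inner_le u v : '[u, v] <= `|u| * `|v|.
Proof. exact: le_trans (ler_norm _) (cauchy_schwarz u v). Qed.

Lemma inner_injr u v : (forall w, '[w, u] = '[w, v]) -> u = v.
Proof.
move=> uv; apply/eqP; rewrite -subr_eq0 -normr_eq0 -sqrf_eq0 -innerxx.
by rewrite innerBr uv subrr.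
Qed.

End Inner.

(** * Minimisation of strongly convex functionals *)

Section Minimisation.
Context {R : realType} {U : hilbertType R}.

(** Strong convexity is asked for midpoints only: applied to two almost
minimising points it bounds their distance, so every minimising sequence is
Cauchy, and lower semi-continuity makes its limit a minimiser. *)
Lemma strongly_convex_min (G : U -> \bar R) (m b : R) (u0 : U) :
  lower_semicontinuous G -> 0 < m ->
  (forall x y r s, (G x <= r%:E)%E -> (G y <= s%:E)%E ->
    (G (2^-1 *: (x + y)) <= (2^-1 * (r + s) - m * `|x - y| ^+ 2)%:E)%E) ->
  (forall x, (b%:E <= G x)%E) -> (G u0 < +oo)%E ->
  exists u, forall x, (G u <= G x)%E.
Proof.
move=> lscG m0 sc bG G0.
pose S := [set r : R | exists x, (G x <= r%:E)%E].
have G0fin : G u0 \is a fin_num.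
  rewrite fin_real// G0 andbT; apply: lt_le_trans (bG _); exact: ltNyr.
have S0 : S !=set0.
  by exists (fine (G u0)), u0; rewrite fineK.
have lbS : lbound S b.
  by move=> r [x Gx]; rewrite -lee_fin; exact: le_trans (bG x) Gx.
have iS : has_inf S by split => //; exists b.
pose g := inf S.
have gG x : (g%:E <= G x)%E.
  have := bG x; case E : (G x) => [r||]// _; last by rewrite leey.
  by rewrite lee_fin; apply: ge_inf; [exists b|exists x; rewrite E].
have appr (e : R) : 0 < e -> exists x, (G x <= (g + e)%:E)%E.
  move=> e0; have [r [x Gx] rl] := inf_adherent e0 iS.
  by exists x; apply: le_trans Gx _; rewrite lee_fin ltW.
have /choice [x_ x_P] : forall n : nat, exists x, (G x <= (g + n.+1%:R^-1)%:E)%E.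
  by move=> n; apply: appr; rewrite invr_gt0.
have dist (i j : nat) : m * `|x_ i - x_ j| ^+ 2 <= 2^-1 * (i.+1%:R^-1 + j.+1%:R^-1).
  have := le_trans (gG _) (sc _ _ _ _ (x_P i) (x_P j)).
  rewrite lee_fin; set a := i.+1%:R^-1; set c := j.+1%:R^-1; lra.
have cx : cvgn x_.
  apply/cauchy_cvgP/cauchyP => e e0.
  have [n n_lt] : exists n : nat, n.+1%:R^-1 < m * e ^+ 2.
    have me0 : 0 < m * e ^+ 2 by rewrite mulr_gt0 // exprn_gt0.
    near \oo => n; exists n; near: n.
    exact: (near_infty_natSinv_lt (PosNum me0)).
  exists (x_ n); exists n => // k /= nk; rewrite -ball_normE /=.
  rewrite -(@ltr_pXn2r _ 2) ?nnegrE ?(ltW e0)// -(ltr_pM2l m0).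
  apply: le_lt_trans (dist _ _) _; apply: le_lt_trans n_lt.
  have : k.+1%:R^-1 <= n.+1%:R^-1 :> R by rewrite lef_pV2 ?posrE// ler_nat.
  by move: (k.+1%:R^-1) (n.+1%:R^-1) => a c; lra.
pose u := limn x_; exists u => x; apply: (le_trans _ (gG x)).
rewrite leNgt; apply/negP => gu.
have [a ga au] : exists2 a, g < a & (a%:E < G u)%E.
  case E : (G u) gu => [r||]// gu.
    by rewrite lte_fin in gu; exists (2^-1 * (g + r)); rewrite ?lte_fin; lra.
  by exists (g + 1); rewrite ?ltry // ltrDl.
have ag : 0 < a - g by rewrite subr_gt0.
have [V nV VG] := lscG _ _ au.
near \oo => n.
have /VG : V (x_ n) by near: n; exact: cx.
apply/negP; rewrite -leNgt; apply: le_trans (x_P n) _; rewrite lee_fin -lerBrDl.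
by apply: ltW; near: n; exact: (near_infty_natSinv_lt (PosNum ag)).
Unshelve. all: by end_near. Qed.

End Minimisation.

(** * Riesz representation, adjoints and the spectrum *)

(** The first-order condition at a minimum, for a function whose increments
are bounded by a quadratic polynomial in the step [t]. *)
Lemma slope_ge0 (R : realType) (p c : R) :
  (forall t, 0 < t -> t <= 1 -> 0 <= t * p + t ^+ 2 * c) -> 0 <= p.
Proof.
move=> H; rewrite leNgt; apply/negP => p0.
have cp : 0 < `|c| - p by have := normr_ge0 c; lra.
(* With this step the quadratic term is too small to compensate [t * p < 0]. *)
pose t := - p / (`|c| - p).
have t0 : 0 < t by rewrite divr_gt0 // oppr_gt0.
have t1 : t <= 1 by rewrite ler_pdivrMr // mul1r; have := normr_ge0 c; lra.
have tE : t * `|c| = - p + t * p by rewrite /t; field; rewrite gt_eqF.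
have := H t t0 t1; apply/negP; rewrite -ltNge.
have tc : t * (t * c) <= t * (t * `|c|) by rewrite !ler_pM2l // ler_norm.
have tp : t * (t * p) < 0 by rewrite !pmulr_rlt0.
rewrite tE in tc; nra.
Qed.

Lemma lipschitz_continuous (R : realType) (U V : normedModType R) (f : U -> V)
    (K : R) :
  (forall x y, `|f x - f y| <= K * `|x - y|) -> continuous f.
Proof.
move=> fK x; apply/cvgrPdist_lt => e e0.
pose K' := Num.max K 1.
have K'0 : 0 < K' by rewrite lt_max ltr01 orbT.
near=> y; apply: le_lt_trans (fK x y) _.
apply: (@le_lt_trans _ _ (K' * `|x - y|)).
  by rewrite ler_wpM2r // le_max lexx.
rewrite -ltr_pdivlMl // mulrC; near: y.
by apply: cvgr_dist_lt => //; rewrite divr_gt0.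
Unshelve. all: by end_near. Qed.

Lemma continuous_linear_le (R : realType) (U V : normedModType R)
    (F : {linear U -> V}) :
  continuous F -> exists2 k : R, 0 < k & forall x, `|F x| <= k * `|x|.
Proof. by move=> /linear_bounded_continuous/linear_boundedP/pinfty_ex_gt0. Qed.

Section Coercive.
Context {R : realType} {U : hilbertType R}.

(** By polarisation, since the norm is continuous. *)
Lemma inner_continuous (T : topologicalType) (f g : T -> U) :
  continuous f -> continuous g -> continuous (fun x => '[f x, g x] : R).
Proof.
move=> fc gc.
have -> : (fun x => '[f x, g x] : R) =
    (fun x => 4^-1 * (`|f x + g x| * `|f x + g x| - `|f x - g x| * `|f x - g x|)).
  apply/funext => x; rewrite -!expr2 normD_sqr normB_sqr; lra.
move=> x; apply: cvgM; first exact: cvg_cst.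
have cD : `|f y + g y| @[y --> x] --> `|f x + g x|.
  by apply: cvg_norm; apply: cvgD; [exact: fc|exact: gc].
have cB : `|f y - g y| @[y --> x] --> `|f x - g x|.
  by apply: cvg_norm; apply: cvgB; [exact: fc|exact: gc].
by apply: cvgB; apply: cvgM.
Qed.

Lemma lsc_EFin (T : topologicalType) (f : T -> R) :
  continuous f -> lower_semicontinuous (fun x => (f x)%:E).
Proof.
move=> fc x a; rewrite lte_fin => ax.
exists [set y | a < f y]; last by move=> y; rewrite /= lte_fin.
exact: (cvgr_gt _ (fc x)).
Qed.

(** The Riesz and Lax-Milgram theorems for symmetric forms: [u] minimises the
energy [2^-1 * '[S x, x] - phi x].  The Riesz theorem is the case
[S = idfun]. *)
Lemma coercive_form_represents (S : {linear U -> U}) (phi : U -> R) (m K : R) :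
  continuous S -> (forall x y, '[S x, y] = '[S y, x]) ->
  0 < m -> (forall x, m * `|x| ^+ 2 <= '[S x, x]) ->
  (forall x y, phi (x + y) = phi x + phi y) ->
  (forall a x, phi (a *: x) = a * phi x) ->
  (forall x, `|phi x| <= K * `|x|) ->
  exists u, forall h, '[S u, h] = phi h.
Proof.
move=> Sc Ssym m0 Sm phiD phiZ phiK.
have phiN x : phi (- x) = - phi x by rewrite -scaleN1r phiZ mulN1r.
pose g x := 2^-1 * '[S x, x] - phi x.
have gZ x h t : g (x + t *: h) =
    g x + (t * ('[S x, h] - phi h) + t ^+ 2 * (2^-1 * '[S h, h])).
  rewrite /g; have -> : S (x + t *: h) = S x + t *: S h by rewrite linearD linearZ.
  rewrite phiD phiZ !(innerDl, innerDr, innerZl, innerZr).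
  rewrite (Ssym h x); lra.
have gc : continuous g.
  move=> x; apply: cvgB; last first.
    apply: (@lipschitz_continuous _ _ R^o phi K) => y z.
    by rewrite -phiN -phiD.
  apply: cvgM; first exact: cvg_cst.
  exact: (inner_continuous Sc (fun y => @cvg_id _ (nbhs y))).
have [u umin] : exists u, forall x, ((g u)%:E <= (g x)%:E)%E.
  (* The lower bound is the minimum over [t] of [m t ^+ 2 / 2 - K t]. *)
  apply: (@strongly_convex_min _ _ (fun x => (g x)%:E) (m / 8)
    (- (K ^+ 2 / (2 * m))) 0) => //.
  - exact: lsc_EFin.
  - by rewrite divr_gt0.
  - move=> x y r s; rewrite !lee_fin => gr gs.
    have -> : 2^-1 *: (x + y) = y + 2^-1 *: (x - y).
      rewrite !scalerDr scalerN addrCA; congr (_ + _).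
      by rewrite -[X in _ = X - _]scale1r -scalerBl; congr (_ *: _); lra.
    have xE : g x = g y + (('[S y, x - y] - phi (x - y)) + 2^-1 * '[S (x - y), x - y]).
      by rewrite -[x in LHS](subrKC y) -[x - y in LHS]scale1r gZ mul1r expr1n mul1r.
    rewrite gZ; rewrite xE in gr; have := Sm (x - y); lra.
  - move=> x; rewrite lee_fin /g.
    have := Sm x; have := phiK x; rewrite ler_norml => /andP[_ xK] xm.
    have : 0 <= (m * `|x| - K) ^+ 2 / (2 * m).
      by rewrite divr_ge0 ?sqr_ge0 // mulr_ge0 // ltW.
    have -> : (m * `|x| - K) ^+ 2 / (2 * m) =
      2^-1 * (m * `|x| ^+ 2) - K * `|x| + K ^+ 2 / (2 * m).
      by field; rewrite gt_eqF.
    lra.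
  - exact: ltry.
have ge0 h : 0 <= '[S u, h] - phi h.
  apply: (@slope_ge0 _ _ (2^-1 * '[S h, h])) => t _ _.
  by have := umin (u + t *: h); rewrite lee_fin gZ lerDl.
exists u => h; apply/eqP; rewrite -subr_eq0 eq_le ge0 andbT.
by have := ge0 (- h); rewrite phiN innerNr -opprD oppr_ge0.
Qed.

Lemma coercive_invertible (S : {linear U -> U}) (m : R) :
  continuous S -> (forall x y, '[S x, y] = '[S y, x]) ->
  0 < m -> (forall x, m * `|x| ^+ 2 <= '[S x, x]) ->
  exists B : U -> U, [/\ continuous B, cancel S B & cancel B S].
Proof.
move=> Sc Ssym m0 Sm.
have Sle x : m * `|x| <= `|S x|.
  have [->|x0] := eqVneq x 0; first by rewrite normr0 mulr0.
  have nx : 0 < `|x| by rewrite normr_gt0.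
  rewrite -(ler_pM2r nx) -mulrA -expr2.
  exact: le_trans (Sm x) (inner_le _ _).
have Sinj : injective S.
  move=> x y Sxy; apply/eqP; rewrite -subr_eq0 -normr_eq0 eq_le normr_ge0 andbT.
  by have := Sle (x - y); rewrite linearB/= Sxy subrr normr0 pmulr_rle0.
have /choice [B SB] : forall y, exists x, S x = y.
  move=> y.
  have [|||u uP] := coercive_form_represents (phi := fun h => '[y, h])
    (K := `|y|) Sc Ssym m0 Sm.
  - by move=> *; rewrite innerDr.
  - by move=> *; rewrite innerZr.
  - by move=> x; exact: cauchy_schwarz.
  - by exists u; apply: inner_injr => w; rewrite innerC uP innerC.
exists B; split => //; last by move=> x; apply: Sinj; rewrite SB.
apply: (@lipschitz_continuous _ _ _ _ m^-1) => x y.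
by rewrite ler_pdivlMl // (le_trans (Sle _)) // linearB/= !SB.
Qed.

End Coercive.

Section Adjoint.
Context {R : realType} {U V : hilbertType R}.

(** The Riesz theorem represents the functionals [u |-> '[F u, v]], so the
default value in [adjoint] is never taken; vectors are determined by their
inner products, which makes the adjoint linear. *)
Lemma adjoint_exists (F : {linear U -> V}) : continuous F ->
  exists2 G : {linear V -> U}, adjoint F = G &
    forall u v, '[F u, v] = '[u, G v].
Proof.
move=> /continuous_linear_le [k k0 Fk].
have adjP u v : '[F u, v] = '[u, adjoint F v].
  have [|||||||w wP] := @coercive_form_represents R U idfun (fun u => '[F u, v]) 1
      (k * `|v|).
  - by move=> x; exact: cvg_id.
  - by move=> x y; rewrite /= innerC.
  - exact: ltr01.
  - by move=> x; rewrite mul1r /= innerxx.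
  - by move=> x y; rewrite linearD innerDl.
  - by move=> a x; rewrite linearZ/= innerZl.
  - move=> x; apply: le_trans (cauchy_schwarz _ _) _.
    by rewrite mulrAC ler_wpM2r.
  rewrite /adjoint; case: xgetP => [y _ yP|/(_ w) H]; first exact: yP.
  by case: H => h; rewrite -wP innerC.
have linG : linear (adjoint F).
  move=> a x y; apply: inner_injr => w.
  by rewrite -adjP !(innerDr, innerZr) !adjP.
pose GL := GRing.isLinear.Build R V U *:%R (adjoint F) linG.
pose G : {linear V -> U} := HB.pack (adjoint F) GL.
by exists G.
Qed.

End Adjoint.

Section Spectrum.
Context {R : realType} {U V : hilbertType R}.
Variables (F : {linear U -> V}) (G : {linear V -> U}) (k : R).
Hypothesis adjFG : forall u v, '[F u, v] = '[u, G v].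
Hypothesis k_gt0 : 0 < k.
Hypothesis Fk : forall x, `|F x| <= k * `|x|.

Lemma adjoint_le v : `|G v| <= k * `|v|.
Proof.
have [->|Gv0] := eqVneq (G v) 0; first by rewrite normr0 mulr_ge0 // ltW.
have nG : 0 < `|G v| by rewrite normr_gt0.
rewrite -(ler_pM2r nG) -expr2 -innerxx -adjFG.
apply: le_trans (inner_le _ _) _.
by rewrite mulrAC ler_wpM2r.
Qed.

(** Outside of the interval one of the symmetric operators [F^* F - l] and
[l - F^* F] is coercive, hence boundedly invertible. *)
Lemma spectrum_normal_sub (l : R) : spectrum (G \o F) l -> 0 <= l <= k ^+ 2.
Proof.
move=> Hl; apply/negP => /negP; rewrite negb_and -!ltNge => lout; apply: Hl.
pose A : {linear U -> U} := G \o F.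
have AF x y : '[A x, y] = '[F x, F y] by rewrite innerC -adjFG innerC.
have Fsq x : `|F x| ^+ 2 <= k ^+ 2 * `|x| ^+ 2.
  by rewrite -exprMn ler_pXn2r ?nnegrE // mulr_ge0 // ltW.
have Gk := adjoint_le.
have Ac : continuous A.
  apply: (@lipschitz_continuous _ _ _ _ (k * k)) => x y.
  rewrite -linearB -mulrA; apply: le_trans (Gk _) _.
  by rewrite ler_wpM2l // ltW.
have Zc : continuous ( *:%R l : U -> U) by exact: scaler_continuous.
case/orP: lout => l_out.
- pose S : {linear U -> U} := A \- *:%R l.
  apply: (@coercive_invertible _ _ S (- l)).
  + by move=> x; apply: cvgB; [exact: Ac|exact: Zc].
  + move=> x y; rewrite !innerBl !innerZl !AF innerC; congr (_ - l * _).
    exact: innerC.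
  + by rewrite oppr_gt0.
  + by move=> x; rewrite innerBl innerZl AF !innerxx mulNr lerDr sqr_ge0.
- pose S : {linear U -> U} := *:%R l \- A.
  have [|||x|B [Bc SB BS]] := @coercive_invertible _ _ S (l - k ^+ 2).
  + by move=> x; apply: cvgB; [exact: Zc|exact: Ac].
  + move=> x y; rewrite !innerBl !innerZl !AF innerC; congr (l * _ - _).
    exact: innerC.
  + by rewrite subr_gt0.
  + by rewrite innerBl innerZl AF !innerxx mulrBl lerB.
  exists (B \o -%R); split.
  + by move=> x; apply: continuous_comp; [exact: opp_continuous|exact: Bc].
  + by move=> x; rewrite /= opprB; exact: SB.
  + by move=> x; rewrite /= -opprB; apply: (canLR (@opprK _)); exact: BS.
Qed.

End Spectrum.

(** * Polynomials in an operator and the Landweber iteration *)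

Section HornerOp.
Context {R : realType} {U : hilbertType R}.
Variable A : {linear U -> U}.
Implicit Types p q : {poly R}.

Lemma horner_op_widen n p x : (size p <= n)%N ->
  horner_op p A x = \sum_(i < n) p`_i *: iter i A x.
Proof.
move=> pn; rewrite /horner_op (big_ord_widen n (fun i => p`_i *: iter i A x)) //.
rewrite [RHS](bigID (fun i : 'I_n => (i < size p)%N)) /= [X in _ = _ + X]big1 ?addr0//.
by move=> i; rewrite -leqNgt => pi; rewrite nth_default // scale0r.
Qed.

Lemma horner_opD p q x : horner_op (p + q) A x = horner_op p A x + horner_op q A x.
Proof.
pose n := maxn (size p) (size q).
rewrite !(@horner_op_widen n) ?leq_maxl ?leq_maxr ?size_polyD// -big_split/=.
by apply: eq_bigr => i _; rewrite coefD scalerDl.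
Qed.

Lemma horner_opZ a p x : horner_op (a *: p) A x = a *: horner_op p A x.
Proof.
rewrite !(@horner_op_widen (size p)) ?size_scale_leq// scaler_sumr.
by apply: eq_bigr => i _; rewrite coefZ scalerA.
Qed.

Lemma horner_op0 x : horner_op 0 A x = 0.
Proof. by rewrite /horner_op size_poly0 big_ord0. Qed.

Lemma horner_op1 x : horner_op 1 A x = x.
Proof. by rewrite /horner_op size_poly1 big_ord1 coef1 scale1r. Qed.

Lemma horner_op_sum n (f : nat -> {poly R}) x :
  horner_op (\sum_(i < n) f i) A x = \sum_(i < n) horner_op (f i) A x.
Proof.
elim: n => [|n IH]; first by rewrite !big_ord0 horner_op0.
by rewrite !big_ord_recr/= horner_opD IH.
Qed.

Lemma horner_opMX p x : horner_op (p * 'X) A x = A (horner_op p A x).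
Proof.
rewrite (@horner_op_widen (size p).+1).
  rewrite big_ord_recl coefMX scale0r add0r /horner_op linear_sum.
  by apply: eq_bigr => i _; rewrite coefMX /= linearZ.
by rewrite (leq_trans (size_polyMleq _ _)) // size_polyX addn2.
Qed.

(** Polynomials in [A] that are combinations of powers of [1 - c X] act through
iterates of the map [1 - c A]; the factor ['X] keeps an [A] in front. *)
Lemma horner_op_landweber c (b : nat -> R) n x :
  horner_op ((\sum_(i < n) b i *: (1 - c *: 'X) ^+ i) * 'X) A x =
  A (\sum_(i < n) b i *: iter i (fun y => y - c *: A y) x).
Proof.
rewrite horner_opMX (horner_op_sum n (fun i => b i *: (1 - c *: 'X) ^+ i)); congr (A _).
apply: eq_bigr => i _; rewrite horner_opZ; congr (_ *: _).
elim: (nat_of_ord i) => [|j IH]; first by rewrite expr0 horner_op1.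
set q := 1 - c *: 'X in IH *.
have -> : q ^+ j.+1 = q ^+ j + (- c) *: (q ^+ j * 'X).
  by rewrite exprSr {2}/q mulrBr mulr1 -scalerAr scaleNr.
by rewrite horner_opD horner_opZ horner_opMX IH scaleNr.
Qed.

End HornerOp.

Section Landweber.
Context {R : realType}.

(** One step of gradient descent for [2^-1 * `|F x| ^+ 2], of length [k ^- 2]. *)
Definition landweber (U V : hilbertType R) (F : U -> V) (G : V -> U) (k : R)
  (x : U) : U := x - (k ^+ 2)^-1 *: G (F x).

(** For this step length the second-order term is at most half of the
first-order decrease.  The estimate serves for [F] and, with the roles
exchanged, for its adjoint. *)
Lemma landweber_descent (U V : hilbertType R)
    (F : U -> V) (G : V -> U) (k : R) :
  (forall u v, '[F u, v] = '[u, G v]) -> 0 < k ->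
  (forall v, `|G v| <= k * `|v|) ->
  forall x, `|landweber F G k x| ^+ 2 + (k ^+ 2)^-1 * `|F x| ^+ 2 <= `|x| ^+ 2.
Proof.
move=> adj k0 Gk x; rewrite normB_sqr normZ_sqr innerZr -adj innerxx.
have k2 : 0 < k ^+ 2 by rewrite exprn_gt0.
have : `|G (F x)| ^+ 2 <= k ^+ 2 * `|F x| ^+ 2.
  by rewrite -exprMn ler_pXn2r ?nnegrE // mulr_ge0 // ltW.
rewrite -ler_pdivrMl // => H.
have : (k ^+ 2)^-1 * ((k ^+ 2)^-1 * `|G (F x)| ^+ 2) <= (k ^+ 2)^-1 * `|F x| ^+ 2.
  by rewrite ler_pM2l ?invr_gt0.
lra.
Qed.

Variables (U V : hilbertType R) (F : {linear U -> V}) (G : {linear V -> U}) (k : R).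
Hypothesis adjFG : forall u v, '[F u, v] = '[u, G v].
Hypothesis k_gt0 : 0 < k.
Hypothesis Fk : forall x, `|F x| <= k * `|x|.

Let T := landweber F G k.
Let T' := landweber G F k.

Lemma landweber_nonexpansive x : `|T x| <= `|x|.
Proof.
rewrite -(@ler_pXn2r _ 2) ?nnegrE //.
apply: le_trans (landweber_descent adjFG k_gt0 (adjoint_le adjFG k_gt0 Fk) x).
by rewrite lerDl mulr_ge0 ?sqr_ge0 // invr_ge0 sqr_ge0.
Qed.

Lemma landweber_sym n x y : '[iter n T x, y] = '[x, iter n T y].
Proof.
have Tsym u v : '[T u, v] = '[u, T v].
  rewrite /T /landweber innerBl innerBr innerZl innerZr -adjFG; congr (_ - _ * _).
  by rewrite innerC -adjFG innerC.
by elim: n x y => // n IH x y; rewrite iterS Tsym IH -iterSr.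
Qed.

(** The iterates of [G w] are the images under [G] of the iterates of the
dual iteration started at [w], whose descent estimates sum up to at most
[`|w| ^+ 2]; since the terms of that sum decrease, the last one is at most
the average. *)
Lemma landweber_decay n w :
  n.+1%:R * `|iter n T (G w)| ^+ 2 <= k ^+ 2 * `|w| ^+ 2.
Proof.
have TG m : G (iter m T' w) = iter m T (G w).
  by elim: m => //= m <-; rewrite {1}/T' /landweber linearB linearZ.
have adjGF u v : '[G u, v] = '[u, F v] by rewrite innerC -adjFG innerC.
have mono i j : (i <= j)%N -> `|iter j T (G w)| <= `|iter i T (G w)|.
  elim: j => [|j IH]; first by rewrite leqn0 => /eqP ->.
  rewrite leq_eqVlt => /predU1P [->//|]; rewrite ltnS => /IH.
  exact: le_trans (landweber_nonexpansive _).
have tele m : (k ^+ 2)^-1 * \sum_(i < m) `|iter i T (G w)| ^+ 2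
    + `|iter m T' w| ^+ 2 <= `|w| ^+ 2.
  elim: m => [|m IH]; first by rewrite big_ord0 mulr0 add0r.
  rewrite big_ord_recr/= -TG.
  have := landweber_descent adjGF k_gt0 Fk (iter m T' w).
  rewrite -/T' mulrDr; lra.
rewrite -ler_pdivrMl ?exprn_gt0 //; apply: le_trans (tele n.+1).
rewrite -[leLHS]addr0 lerD ?sqr_ge0 // ler_pM2l ?invr_gt0 ?exprn_gt0 //.
rewrite mulr_natl -[X in _ *+ X]card_ord -sumr_const ler_sum // => i _.
by rewrite ler_pXn2r ?nnegrE // mono // -ltnS.
Qed.

End Landweber.

(** * Partial sums of the binomial series *)

Section Binomial.
Context {R : realType}.
Implicit Types (a be mu x z : R) (n : nat).

(** The Taylor coefficients at 0 of [(1 - x) `^ (- mu)]. *)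
Definition binom_coef mu n : R := \prod_(i < n) ((i%:R + mu) / i.+1%:R).

Lemma binom_coef0 mu : binom_coef mu 0 = 1.
Proof. by rewrite /binom_coef big_ord0. Qed.

Lemma binom_coefS mu n :
  n.+1%:R * binom_coef mu n.+1 = (n%:R + mu) * binom_coef mu n.
Proof.
rewrite {1}/binom_coef big_ord_recr/= -/(binom_coef mu n).
by field; rewrite addrC natr1 pnatr_eq0.
Qed.

Lemma binom_coef_ge0 mu n : 0 <= mu -> 0 <= binom_coef mu n.
Proof. by move=> mu0; apply: prodr_ge0 => i _; rewrite divr_ge0 ?addr_ge0 ?ler0n. Qed.

(** Bernoulli's inequality, a case of Young's inequality. *)
Lemma powR_bernoulli a z : 0 <= a -> a <= 1 -> 0 <= z -> z `^ a <= 1 + a * (z - 1).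
Proof.
move=> a0 a1 z0.
have [->|an0] := eqVneq a 0; first by rewrite powRr0 mul0r addr0.
have [->|an1] := eqVneq a 1; first by rewrite powRr1 // mul1r addrC subrK.
have {a0 an0} a0 : 0 < a by rewrite lt_neqAle eq_sym an0.
have {a1 an1} a1 : 0 < 1 - a by rewrite subr_gt0 lt_neqAle an1.
have := @conjugate_powR _ (z `^ a) 1 a^-1 (1 - a)^-1.
rewrite powR_ge0 !invr_gt0 !invrK powR1 -powRrM divff ?gt_eqF // powRr1 //.
rewrite mulr1 addrCA subrr addr0 => /(_ isT ler01 a0 a1 erefl); lra.
Qed.

(** A discrete antiderivative: the right-hand side telescopes, which bounds sums
of [(n + 1) `^ (mu - 1)]. *)
Lemma powR_diff_ge mu x : 0 <= mu -> mu <= 1 -> 0 <= x ->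
  mu * (x + 1) `^ (mu - 1) <= (x + 1) `^ mu - x `^ mu.
Proof.
move=> mu0 mu1 x0.
have x1 : 0 < x + 1 by rewrite ltr_wpDl.
have xE : x `^ mu = (x + 1) `^ mu * (x / (x + 1)) `^ mu.
  by rewrite -powRM ?divr_ge0 ?(ltW x1) // mulrCA divff ?gt_eqF // mulr1.
have : (x / (x + 1)) `^ mu <= 1 - mu * (x + 1)^-1.
  apply: le_trans (powR_bernoulli _ _ _) _ => //; first by rewrite divr_ge0 // ltW.
  rewrite le_eqVlt; apply/orP; left; apply/eqP; field.
  by rewrite gt_eqF.
rewrite powRB; last by rewrite (gt_eqF x1) implybT.
rewrite powRr1 ?(ltW x1) // -(ler_pM2l (powR_gt0 mu x1)) -xE; lra.
Qed.

(** The analogue of [powR_diff_ge] for a negative exponent, which bounds tails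
of convergent series. *)
Lemma powRN_diff_ge be x : 0 <= be -> be <= 1 -> 0 < x ->
  be * (x + 1) `^ (- be - 1) <= x `^ (- be) - (x + 1) `^ (- be).
Proof.
move=> be0 be1 x0.
have x1 : 0 < x + 1 by rewrite ltr_wpDl ?ltW.
set y := x / (x + 1).
have y0 : 0 < y by rewrite divr_gt0.
have xE : x `^ (- be) = (x + 1) `^ (- be) * y `^ (- be).
  by rewrite -powRM ?(ltW x1) ?(ltW y0) // mulrCA divff ?gt_eqF // mulr1.
have yb0 : 0 < y `^ be by rewrite powR_gt0.
have yb : y `^ be <= 1 - be * (x + 1)^-1.
  apply: le_trans (powR_bernoulli _ _ _) _ => //; first exact: ltW.
  rewrite le_eqVlt; apply/orP; left; apply/eqP; rewrite /y; field.
  by rewrite gt_eqF.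
have : 2 - y `^ be <= y `^ (- be).
  rewrite powRN -(ler_pM2r yb0) mulVf ?gt_eqF //.
  have := sqr_ge0 (1 - y `^ be); lra.
rewrite powRB; last by rewrite (gt_eqF x1) implybT.
rewrite powRr1 ?(ltW x1) // => yN.
have : 1 + be * (x + 1)^-1 <= y `^ (- be) by lra.
rewrite -(ler_pM2l (powR_gt0 (- be) x1)) -xE; lra.
Qed.

Lemma binom_coef_le mu n : 0 <= mu -> mu <= 1 ->
  binom_coef mu n <= n.+1%:R `^ (mu - 1).
Proof.
move=> mu0 mu1; elim: n => [|n IH]; first by rewrite binom_coef0 powR1.
have n0 : 0 < n.+1%:R :> R by [].
rewrite -(ler_pM2l n0) binom_coefS.
apply: le_trans (ler_wpM2l _ IH) _; first by rewrite addr_ge0.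
have n1 : 0 < n.+2%:R :> R by [].
set z : R := n.+2%:R / n.+1%:R.
have z0 : 0 < z by rewrite divr_gt0.
have nE : n.+1%:R `^ (mu - 1) = n.+2%:R `^ (mu - 1) * z `^ (1 - mu) :> R.
  have -> : n.+2%:R = n.+1%:R * z :> R by rewrite mulrCA divff ?mulr1 ?gt_eqF.
  rewrite powRM ?(ltW z0) // -mulrA -powRD ?(gt_eqF z0) ?implybT //.
  by rewrite (_ : mu - 1 + (1 - mu) = 0) ?powRr0 ?mulr1 //; ring.
rewrite nE mulrCA [leRHS]mulrC ler_pM2l ?powR_gt0 //.
have zb : z `^ (1 - mu) <= 1 + (1 - mu) * n.+1%:R^-1.
  apply: le_trans (powR_bernoulli _ _ (ltW z0)) _; try lra.
  rewrite le_eqVlt; apply/orP; left; apply/eqP; rewrite /z -[n.+2%:R]natr1.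
  by field; rewrite addrC natr1 pnatr_eq0.
have nmu : 0 <= n%:R + mu by rewrite addr_ge0.
apply: le_trans (ler_wpM2l nmu zb) _.
have nE1 : n%:R = n.+1%:R - 1 :> R by rewrite -natr1 addrK.
have ni : n.+1%:R * n.+1%:R^-1 = 1 :> R by rewrite divff // gt_eqF.
have i0 : 0 < n.+1%:R^-1 :> R by rewrite invr_gt0.
rewrite nE1; move: n.+1%:R (n.+1%:R^-1) ni i0 => c d cd d0.
have -> : (c - 1 + mu) * (1 + (1 - mu) * d) =
  c - (1 - mu) + (1 - mu) * (c * d) - (1 - mu) ^+ 2 * d by ring.
rewrite cd; have : 0 <= (1 - mu) ^+ 2 * d by rewrite mulr_ge0 ?sqr_ge0 // ltW.
lra.
Qed.

Lemma is_derive_ler1 (f df : R -> R) x : 0 < x -> x <= 1 ->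
  (forall y : R, 0 < y -> is_derive y 1 f (df y)) ->
  (forall y, 0 < y -> y <= 1 -> 0 <= df y) -> f x <= f 1.
Proof.
move=> x0 x1 fdf df0; rewrite -subr_ge0.
have [|||c] := @MVT_segment _ f df x 1 => //.
- by move=> y; rewrite in_itv/= => /andP[xy _]; apply: fdf; exact: lt_trans xy.
- apply: derivable_within_continuous => y; rewrite in_itv/= => /andP[xy _].
  by have [] := fdf y (lt_le_trans x0 xy).
- rewrite in_itv/= => /andP[xc c1] ->; rewrite mulr_ge0 ?subr_ge0 //.
  by apply: df0 => //; exact: lt_le_trans xc.
Qed.

Definition binom_sum mu n x : R := \sum_(i < n) binom_coef mu i * x ^+ i.

Lemma is_derive_binom_term c n s x : 0 < x ->
  is_derive x 1 (fun y : R => c * ((1 - y) ^+ n * y `^ s))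
    (c * ((1 - x) ^+ n * (s * x `^ (s - 1)) - x `^ s * (n%:R * (1 - x) ^+ n.-1))).
Proof.
move=> x0.
have D1 : is_derive x 1 (fun y : R => 1 - y) (-1).
  have := is_deriveB (is_derive_cst (1 : R) x 1) (is_derive_id x 1).
  by rewrite sub0r.
have D2 := is_deriveM (is_deriveX n D1) (@is_derive1_powR R s x x0).
have fXE (y : R) : ((fun y : R => 1 - y) ^+ n) y = (1 - y) ^+ n by rewrite exprfctE.
have -> : (fun y : R => c * ((1 - y) ^+ n * y `^ s)) =
    c \*: ((fun y : R => 1 - y) ^+ n * (powR (R:=R))^~ s).
  by apply/funext => y /=; rewrite /GRing.scale/= -fXE.
apply: is_derive_eq.
by rewrite fXE /GRing.scale/=; ring.
Qed.

(** The recursion of the coefficients makes all but one monomial of the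
derivative cancel. *)
Lemma is_derive_binom_sum mu n x : 0 < x ->
  is_derive x 1 (fun y => binom_sum mu n.+1 (1 - y) * y `^ mu)
    (n.+1%:R * binom_coef mu n.+1 * (1 - x) ^+ n * x `^ (mu - 1)).
Proof.
move=> x0.
have xmu : x `^ mu = x * x `^ (mu - 1).
  rewrite powRB ?(gt_eqF x0) ?implybT // powRr1 ?(ltW x0) //.
  by field; rewrite gt_eqF.
elim: n => [|n IH].
  have -> : (fun y => binom_sum mu 1 (1 - y) * y `^ mu) = @powR R ^~ mu.
    by apply/funext => y; rewrite /binom_sum big_ord1 binom_coef0 !mul1r.
  by rewrite binom_coefS binom_coef0 add0r !mulr1; exact: is_derive1_powR.
have -> : (fun y => binom_sum mu n.+2 (1 - y) * y `^ mu) =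
    (fun y => binom_sum mu n.+1 (1 - y) * y `^ mu) +
    (fun y => binom_coef mu n.+1 * ((1 - y) ^+ n.+1 * y `^ mu)).
  by apply/funext => y; rewrite /binom_sum big_ord_recr/= mulrDl -mulrA.
have D := is_deriveD IH (is_derive_binom_term (binom_coef mu n.+1) n.+1 mu x0).
apply: is_derive_eq.
rewrite (binom_coefS mu n.+1) xmu exprS /=; ring.
Qed.

Lemma binom_sum0 mu n : binom_sum mu n.+1 0 = 1.
Proof.
rewrite /binom_sum big_ord_recl/= binom_coef0 expr0 mulr1.
by rewrite big1 ?addr0 // => i _; rewrite /bump add1n exprS mul0r mulr0.
Qed.

(** After multiplication by [x `^ (mu - 1)] the left-hand side is a
nondecreasing function of [x], by [is_derive_binom_sum], with value 1 at
[x = 1]. *)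
Lemma binom_sum_le mu n x : 0 <= mu -> 0 <= x -> x <= 1 ->
  x * binom_sum mu n.+1 (1 - x) <= x `^ (1 - mu).
Proof.
move=> mu0; rewrite le_eqVlt => /predU1P[<- _|x0 x1].
  by rewrite mul0r powR_ge0.
have H : binom_sum mu n.+1 (1 - x) * x `^ mu <= 1.
  have := is_derive_ler1 x0 x1 (@is_derive_binom_sum mu n).
  rewrite subrr powR1 mulr1 binom_sum0; apply => y y0 y1.
  rewrite mulr_ge0 ?powR_ge0 // mulr_ge0 ?exprn_ge0 ?subr_ge0 //.
  by rewrite mulr_ge0 ?ler0n // binom_coef_ge0.
have xE : x `^ (1 - mu) * x `^ mu = x.
  by rewrite -powRD ?(gt_eqF x0) ?implybT // subrK powRr1 // ltW.
by rewrite -{1}xE -mulrA [_ * binom_sum _ _ _]mulrC ler_piMr // powR_ge0.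
Qed.

(** The remainder is controlled by adding one more term, which turns the
nondecreasing function of [binom_sum_le] into a nonincreasing one with the
same value at 1. *)
Lemma binom_sum_ge mu n x : 0 <= mu -> mu < 1 -> 0 <= x -> x <= 1 ->
  x `^ (1 - mu) <= x * binom_sum mu n.+1 (1 - x) + binom_coef mu n.+1.
Proof.
move=> mu0 mu1; rewrite le_eqVlt => /predU1P[<- _|x0 x1].
  by rewrite mul0r powR0 ?add0r ?binom_coef_ge0 // subr_eq0 gt_eqF.
set b := binom_coef mu n.+1.
have b0 : 0 <= b by exact: binom_coef_ge0.
have := @is_derive_ler1 (- (fun y => binom_sum mu n.+1 (1 - y) * y `^ mu) +
    (fun y => - b * ((1 - y) ^+ n.+1 * y `^ (mu - 1))))
  (fun y => b * ((1 - y) ^+ n.+1 * ((1 - mu) * y `^ (mu - 1 - 1)))) x x0 x1.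
rewrite !fctE subrr powR1 mulr1 binom_sum0 expr0n /= mul0r mulr0 addr0 => H.
have {H} : 1 <= binom_sum mu n.+1 (1 - x) * x `^ mu +
    b * ((1 - x) ^+ n.+1 * x `^ (mu - 1)).
  have : - (binom_sum mu n.+1 (1 - x) * x `^ mu) +
    - b * ((1 - x) ^+ n.+1 * x `^ (mu - 1)) <= - 1; last by lra.
  apply: H => y y0.
    have D := is_deriveD (is_deriveN (is_derive_binom_sum mu n y0))
      (is_derive_binom_term (- b) n.+1 (mu - 1) y0).
    by apply: is_derive_eq; rewrite -/b /=; ring.
  move=> y1; rewrite !mulr_ge0 ?powR_ge0 ?exprn_ge0 ?subr_ge0 //; exact: ltW.
have xE : x `^ (1 - mu) * x `^ mu = x.
  by rewrite -powRD ?(gt_eqF x0) ?implybT // subrK powRr1 // ltW.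
have xE' : x `^ (1 - mu) * x `^ (mu - 1) = 1.
  rewrite -powRD ?(gt_eqF x0) ?implybT //.
  by rewrite (_ : 1 - mu + (mu - 1) = 0) ?powRr0 //; ring.
rewrite -(ler_pM2l (powR_gt0 (1 - mu) x0)) mulr1 => /le_trans; apply.
rewrite mulrDr [in leLHS]mulrCA xE [X in _ + X]mulrCA.
rewrite [X in _ + _ * X]mulrCA xE' mulr1 [x * _]mulrC lerD2l ler_piMr //.
by rewrite exprn_ile1 ?subr_ge0 // lerBlDr lerDl ltW.
Qed.

(** Multiplication by [x] makes the convergence of the binomial series of
[x `^ (- mu)] uniform up to the singularity at 0. *)
Lemma binom_sum_approx mu n x : 0 <= mu -> mu < 1 -> 0 <= x -> x <= 1 ->
  `|x * binom_sum mu n.+1 (1 - x) - x `^ (1 - mu)| <= n.+2%:R `^ (mu - 1).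
Proof.
move=> mu0 mu1 x0 x1; rewrite ler_distlC.
have le1 := binom_sum_le n mu0 x0 x1.
have le2 := binom_sum_ge n mu0 mu1 x0 x1.
have le3 := binom_coef_le n.+1 mu0 (ltW mu1).
have : 0 <= n.+2%:R `^ (mu - 1) :> R by rewrite powR_ge0.
by move=> ?; apply/andP; split; lra.
Qed.
End Binomial.

(** * Interpolation for binomial-weighted sums *)

Section Interpolation.
Context {R : realType}.

Lemma nat_between (x : R) : 1 <= x -> exists N : nat, x <= N%:R /\ N%:R <= 2 * x.
Proof.
move=> x1; have x0 : 0 <= x by lra.
have /andP[t1 t2] := truncn_itv x0.
exists (Num.truncn x).+1; split; first exact: ltW.
rewrite -natr1; lra.
Qed.

(** With the plain bound [s k <= a], useful for the terms of small index. *)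
Lemma binom_sum_head mu (a : R) (s : nat -> R) n : 0 < mu -> mu <= 1 ->
  (forall k, 0 <= s k) -> (forall k, s k <= a) ->
  \sum_(k < n) binom_coef mu k * s k <= a / mu * n%:R `^ mu.
Proof.
move=> mu0 mu1 s0 sa.
have a0 : 0 <= a by exact: le_trans (s0 0%N) (sa 0%N).
elim: n => [|n IH]; first by rewrite big_ord0 mulr_ge0 ?powR_ge0 // divr_ge0 // ltW.
rewrite big_ord_recr/=.
have bs : binom_coef mu n * s n <= n.+1%:R `^ (mu - 1) * a.
  by apply: ler_pM => //; [rewrite binom_coef_ge0 // ltW|rewrite binom_coef_le // ltW].
have := @powR_diff_ge _ mu n%:R (ltW mu0) mu1 (ler0n _ _).
rewrite natr1 => H.
have am : 0 <= a / mu by rewrite divr_ge0 // ltW.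
have := ler_wpM2l am H.
have -> : a / mu * (mu * n.+1%:R `^ (mu - 1)) = n.+1%:R `^ (mu - 1) * a.
  by field; rewrite gt_eqF.
lra.
Qed.

(** With the decay [s k <= b / sqrt (k + 1)], useful for the terms of large
index: since [mu < 1/2], the resulting series converges. *)
Lemma binom_sum_tail mu (b : R) (s : nat -> R) (N m : nat) : 0 <= mu -> mu < 2^-1 ->
  (0 < N)%N -> 0 <= b ->
  (forall k, 0 <= s k) -> (forall k, k.+1%:R * s k ^+ 2 <= b ^+ 2) ->
  \sum_(k < N + m) binom_coef mu k * s k <=
  \sum_(k < N) binom_coef mu k * s k +
  b / (2^-1 - mu) * (N%:R `^ (- (2^-1 - mu)) - (N + m)%:R `^ (- (2^-1 - mu))).
Proof.
move=> mu0 mu1 N0 b0 s0 sb.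
elim: m => [|m IH]; first by rewrite addn0 subrr mulr0 addr0.
rewrite addnS big_ord_recr/=; set n := (N + m)%N in IH *.
have n0 : 0 < n%:R :> R by rewrite ltr0n addn_gt0 N0.
have n1 : 0 < n.+1%:R :> R by [].
have sn : s n <= b * n.+1%:R `^ (- 2^-1).
  have p0 : 0 < n.+1%:R `^ 2^-1 :> R by rewrite powR_gt0.
  have pp : (n.+1%:R `^ 2^-1) ^+ 2 = n.+1%:R :> R.
    by rewrite powR12_sqrt ?sqr_sqrtr // ltW.
  rewrite powRN ler_pdivlMr // -(@ler_pXn2r _ 2) ?nnegrE ?mulr_ge0 ?powR_ge0 //.
  by rewrite exprMn pp mulrC.
have bs : binom_coef mu n * s n <= n.+1%:R `^ (mu - 1) * (b * n.+1%:R `^ (- 2^-1)).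
  apply: ler_pM => //; first by rewrite binom_coef_ge0.
  by rewrite binom_coef_le //; lra.
have be0 : 0 < 2^-1 - mu by rewrite subr_gt0.
have := @powRN_diff_ge _ (2^-1 - mu) n%:R (ltW be0) _ n0.
rewrite natr1 => /(_ _)/wrap[|H]; first by lra.
have bb : 0 <= b / (2^-1 - mu) by rewrite divr_ge0 // ltW.
have := ler_wpM2l bb H.
have -> : b / (2^-1 - mu) * ((2^-1 - mu) * n.+1%:R `^ (- (2^-1 - mu) - 1)) =
    n.+1%:R `^ (mu - 1) * (b * n.+1%:R `^ (- 2^-1)).
  have -> : - (2^-1 - mu) - 1 = (mu - 1) + - 2^-1 by lra.
  rewrite powRD ?(gt_eqF n1) ?implybT //.
  by move: be0; set be := 2^-1 - mu => be0; field; rewrite gt_eqF.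
lra.
Qed.

(** The sum is split at an index [N] comparable to [(b / a) ^+ 2], where the
two bounds on [s] cross; for [mu = 0] only the first term is nonzero. *)
Lemma binom_sum_interpolation (mu : R) : 0 <= mu -> mu < 2^-1 ->
  exists2 C : R, 0 < C & forall (a b : R) (s : nat -> R) n, 0 <= a -> a <= b ->
    (forall k, 0 <= s k) -> (forall k, s k <= a) ->
    (forall k, k.+1%:R * s k ^+ 2 <= b ^+ 2) ->
    \sum_(k < n) binom_coef mu k * s k <= C * (a `^ (1 - 2 * mu) * b `^ (2 * mu)).
Proof.
move=> mu0 mu1.
have [->|mun0] := eqVneq mu 0.
  exists 1 => // a b s n a0 ab s0 sa _.
  rewrite mulr0 subr0 powRr0 powRr1 // mul1r mulr1.
  case: n => [|n]; first by rewrite big_ord0.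
  rewrite big_ord_recl/= binom_coef0 mul1r big1 ?addr0 // => i _.
  by rewrite /binom_coef /bump add1n big_ord_recl/= addr0 !mul0r.
have {mu0 mun0} mu0 : 0 < mu by rewrite lt_neqAle eq_sym mun0.
have be0 : 0 < 2^-1 - mu by rewrite subr_gt0.
exists (2 / mu + 1 / (2^-1 - mu)); first by rewrite addr_gt0 // divr_gt0.
move=> a b s n; rewrite le_eqVlt => /predU1P[<- b0 s0 sa _|a0 ab s0 sa sb].
  rewrite big1 => [|i _]; last first.
    by rewrite (_ : s i = 0) ?mulr0 //; apply/le_anti; rewrite sa s0.
  by rewrite mulr_ge0 ?mulr_ge0 ?powR_ge0 // addr_ge0 // divr_ge0 // ltW.
have b0 : 0 < b by exact: lt_le_trans ab.
pose r := b / a.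
have r1 : 1 <= r by rewrite ler_pdivlMr // mul1r.
have r0 : 0 < r by lra.
have [N [xN Nx]] := @nat_between (r ^+ 2) (exprn_ege1 _ r1).
have r20 : 0 < r ^+ 2 by rewrite exprn_gt0.
have N0 : (0 < N)%N by rewrite -(ltr0n R); exact: lt_le_trans xN.
have NR0 : 0 < N%:R :> R by rewrite ltr0n.
have le_ext : \sum_(k < n) binom_coef mu k * s k <=
    \sum_(k < N + n) binom_coef mu k * s k.
  rewrite addnC big_split_ord/= lerDl sumr_ge0 // => i _.
  by rewrite mulr_ge0 // binom_coef_ge0 // ltW.
apply: le_trans le_ext _.
apply: le_trans (binom_sum_tail n (ltW mu0) mu1 N0 (ltW b0) s0 sb) _.
have mu_le1 : mu <= 1 by lra.
have := binom_sum_head N mu0 mu_le1 s0 sa.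
set be := 2^-1 - mu.
set Q := a `^ (1 - 2 * mu) * b `^ (2 * mu).
have rE p : r `^ p = b `^ p * a `^ (- p).
  by rewrite /r powRM ?invr_ge0 ?(ltW a0) ?(ltW b0) // -powR_inv1 ?(ltW a0) // -powRrM mulN1r.
have rsq p : (r ^+ 2) `^ p = r `^ (2 * p).
  by rewrite -powR_mulrn ?(ltW r0) // -powRrM.
have Q1 : a * r `^ (2 * mu) = Q.
  rewrite rE mulrCA -{1}(powRr1 (ltW a0)) -powRD ?(gt_eqF a0) ?implybT //.
  by rewrite mulrC.
have Q2 : b * r `^ (2 * - be) = Q.
  rewrite rE mulrA -{1}(powRr1 (ltW b0)) -powRD ?(gt_eqF b0) ?implybT //.
  by rewrite mulrC /be; congr (_ `^ _ * _ `^ _); lra.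
have h1 : a / mu * N%:R `^ mu <= 2 / mu * Q.
  have -> : 2 / mu * Q = a / mu * (2 * r `^ (2 * mu)).
    by rewrite -Q1; field; rewrite gt_eqF.
  apply: ler_wpM2l; first by rewrite divr_ge0 // ltW.
  apply: (@le_trans _ _ ((2 * r ^+ 2) `^ mu)).
    apply: ge0_ler_powR Nx; rewrite ?nnegrE ?ler0n ?(ltW mu0) //.
    by rewrite mulr_ge0 ?(ltW r20).
  rewrite powRM ?(ltW r20) // rsq ler_wpM2r ?powR_ge0 //.
  by rewrite -[leRHS]powRr1 // ler_powR //; lra.
have h2 : b / be * N%:R `^ (- be) <= 1 / be * Q.
  have -> : 1 / be * Q = b / be * r `^ (2 * - be).
    by rewrite -Q2; field; rewrite gt_eqF.
  apply: ler_wpM2l; first by rewrite divr_ge0 // ltW.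
  rewrite -rsq !powRN lef_pV2 ?posrE ?powR_gt0 //.
  by apply: ge0_ler_powR => //; rewrite ?nnegrE; apply: ltW.
have h3 : 0 <= b / be * (N + n)%:R `^ (- be).
  by rewrite mulr_ge0 ?powR_ge0 // divr_ge0 // ltW.
lra.
Qed.

End Interpolation.

(** * Consequences of the source condition *)

Lemma uniform_cvg_bound (R : realType) (D : set R) (f : nat -> R -> R) (g : R -> R)
    (r : nat -> R) :
  (forall n t, D t -> `|f n t - g t| <= r n) -> r @ \oo --> 0 ->
  {uniform D, f @ \oo --> g}.
Proof.
move=> fg r0 P /uniform_nbhs [E [entE sub]].
have [e /= e0 eE] : exists2 e : R, 0 < e & [set xy | ball xy.1 e xy.2] `<=` E.
  by move: entE; rewrite -entourage_ballE => -[e e0 eE]; exists e.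
have rn : \forall n \near \oo, r n < e by exact: (cvgr_lt _ r0).
near=> n; apply: sub => y Dy; apply: eE; rewrite -ball_normE /= distrC.
apply: le_lt_trans (fg n y Dy) _; near: n; exact: rn.
Unshelve. all: by end_near. Qed.

Lemma powR_natN_cvg0 (R : realType) (p : R) : 0 < p ->
  (fun n => n.+2%:R `^ (- p) : R) @ \oo --> (0 : R).
Proof.
move=> p0; apply/cvgrPdist_lt => e e0.
near=> n; rewrite sub0r normrN ger0_norm ?powR_ge0 // powRN.
rewrite -[ltRHS]invrK ltf_pV2 ?posrE ?invr_gt0 ?powR_gt0 //.
have eE : e^-1 = ((e^-1) `^ p^-1) `^ p.
  by rewrite -powRrM mulVf ?gt_eqF // powRr1 // invr_ge0 ltW.
rewrite eE gt0_ltr_powR ?nnegrE ?powR_ge0 //.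
apply: (@lt_trans _ _ n%:R); last by rewrite ltr_nat.
near: n; exact: nbhs_infty_gtr.
Unshelve. all: by end_near. Qed.

Section Source.
Context {R : realType} {U V : hilbertType R}.
Variables (F : {linear U -> V}) (G : {linear V -> U}) (k : R).
Hypothesis adjFG : forall u v, '[F u, v] = '[u, G v].
Hypothesis k_gt0 : 0 < k.
Hypothesis Fk : forall x, `|F x| <= k * `|x|.

Let landweber_poly (nu : R) n : {poly R} :=
  (k ^+ 2) `^ (nu - 1) *:
  ((\sum_(i < n.+1) binom_coef (1 - nu) i *: (1 - (k ^+ 2)^-1 *: 'X) ^+ i) * 'X).

(** On [[0, k ^+ 2]], which contains the spectrum, the error is
[(k ^+ 2) `^ nu] times that of [binom_sum_approx]. *)
Lemma landweber_poly_cvg nu : 2^-1 < nu -> nu <= 1 ->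
  {uniform spectrum (G \o F),
    (fun n t => (landweber_poly nu n).[t]) @ \oo --> (fun t => t `^ nu)}.
Proof.
move=> nu0 nu1.
have L0 : 0 < k ^+ 2 by rewrite exprn_gt0.
apply: (@uniform_cvg_bound _ _ _ _
  (fun n => (k ^+ 2) `^ nu * n.+2%:R `^ (- nu))); last first.
  rewrite -[X in _ --> X](mulr0 ((k ^+ 2) `^ nu)).
  apply: cvgM; [exact: cvg_cst|apply: powR_natN_cvg0; lra].
move=> n t /(spectrum_normal_sub adjFG k_gt0 Fk) /andP[t0 tL].
pose x := t / k ^+ 2.
have x0 : 0 <= x by rewrite divr_ge0 // ltW.
have x1 : x <= 1 by rewrite ler_pdivrMr // mul1r.
have tE : t = k ^+ 2 * x by rewrite /x mulrCA divff ?mulr1 // gt_eqF.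
have -> : (landweber_poly nu n).[t] =
    (k ^+ 2) `^ nu * (x * binom_sum (1 - nu) n.+1 (1 - x)).
  rewrite /landweber_poly hornerZ hornerMX horner_sum /binom_sum.
  have -> : (k ^+ 2) `^ nu = (k ^+ 2) `^ (nu - 1) * k ^+ 2.
    by rewrite mulrC mulr_powRB1 ?(ltW L0) //; lra.
  rewrite -mulrA; congr (_ * _); rewrite mulrA -tE mulrC; congr (_ * _).
  apply: eq_bigr => i _; rewrite hornerZ horner_exp !hornerE.
  by congr (_ * (1 - _) ^+ _); rewrite mulrC.
rewrite tE powRM ?(ltW L0) // -mulrBr normrM ger0_norm ?powR_ge0 //.
rewrite ler_wpM2l ?powR_ge0 //.
have := @binom_sum_approx _ (1 - nu) n x _ _ x0 x1.
have -> : 1 - (1 - nu) = nu by ring.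
have -> : 1 - nu - 1 = - nu by ring.
apply; lra.
Qed.

(** Read [F h] as an approximation of a vector [pdag] with [G pdag = xi], where
[xi] is the source element [(F^* F)^nu eta]; the constant [c] does not
depend on the accuracy [e]. *)
Lemma source_interpolation (nu : R) (eta : U) : 2^-1 < nu -> nu <= 1 ->
  exists2 c : R, 0 < c & forall e : R, 0 < e -> exists2 h : U,
    `|G (F h) - op_powR (G \o F) nu eta| <= e &
    forall w, `|'[F h, w]| <= c * (`|w| `^ (2 - 2 * nu) * `|G w| `^ (2 * nu - 1)).
Proof.
move=> nu0 nu1; rewrite /op_powR /spectral_calculus.
(* At the default value 0 of the functional calculus, [h = 0] will do. *)
case: xgetP => [B _ HB|_]; last first.
  exists 1 => // e e0; exists 0 => [|w].
    by rewrite !linear0 /= addr0 normr0 ltW.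
  by rewrite raddf0 inner0l normr0 mul1r mulr_ge0 ?powR_ge0.
have L0 : 0 < k ^+ 2 by rewrite exprn_gt0.
have mu0 : 0 <= 1 - nu by rewrite subr_ge0.
have mu1 : 1 - nu < 2^-1 by lra.
have [C C0 HC] := binom_sum_interpolation mu0 mu1.
pose c := (k ^+ 2) `^ (nu - 1) * (`|eta| * (C * k `^ (2 - 2 * nu))).
have c0 : 0 <= c by rewrite !mulr_ge0 ?powR_ge0 // ltW.
exists (c + 1); first by rewrite ltr_wpDl.
move=> e e0.
have eta1 : 0 < `|eta| + 1 by rewrite ltr_wpDl.
have e'0 : 0 < e / (`|eta| + 1) by rewrite divr_gt0.
have := HB _ (landweber_poly_cvg nu0 nu1) _ e'0.
case=> n _ /(_ n (leqnn n)) /(_ eta) Hn.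
pose T := landweber F G k.
pose h := (k ^+ 2) `^ (nu - 1) *:
  \sum_(i < n.+1) binom_coef (1 - nu) i *: iter i T eta.
have hE : horner_op (landweber_poly nu n) (G \o F) eta = G (F h).
  have FGZ a x : G (F (a *: x)) = a *: G (F x) by rewrite !linearZ.
  rewrite /landweber_poly horner_opZ /h FGZ; congr (_ *: _).
  exact: (horner_op_landweber (G \o F) (k ^+ 2)^-1 (binom_coef (1 - nu)) n.+1 eta).
exists h.
  rewrite -hE; apply: le_trans Hn _.
  by rewrite mulrAC ler_pdivrMr // ler_wpM2l ?(ltW e0) // lerDl.
move=> w; rewrite adjFG /h innerZl normrM (ger0_norm (powR_ge0 _ _)).
apply: (@le_trans _ _ (c * (`|w| `^ (2 - 2 * nu) * `|G w| `^ (2 * nu - 1)))); last first.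
  by rewrite ler_wpM2r ?mulr_ge0 ?powR_ge0 // lerDl.
rewrite /c -mulrA ler_wpM2l ?powR_ge0 //.
pose s i := `|iter i T (G w)|.
have := HC `|G w| (k * `|w|) s n.+1 (normr_ge0 _) (adjoint_le adjFG k_gt0 Fk w) _ _ _.
have -> : 1 - 2 * (1 - nu) = 2 * nu - 1 by ring.
have -> : 2 * (1 - nu) = 2 - 2 * nu by ring.
rewrite powRM ?(ltW k_gt0) // => H.
have {}H : \sum_(k0 < n.+1) binom_coef (1 - nu) k0 * s k0 <=
   C * (`|G w| `^ (2 * nu - 1) * (k `^ (2 - 2 * nu) * `|w| `^ (2 - 2 * nu))).
  apply: H => [i||i].
  - exact: normr_ge0.
  - elim=> [|i]; first by rewrite /s.
    exact: le_trans (landweber_nonexpansive adjFG k_gt0 Fk _).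
  - by rewrite exprMn; exact: landweber_decay.
have -> : `|eta| * (C * k `^ (2 - 2 * nu)) * (`|w| `^ (2 - 2 * nu) * `|G w| `^ (2 * nu - 1))
  = `|eta| * (C * (`|G w| `^ (2 * nu - 1) * (k `^ (2 - 2 * nu) * `|w| `^ (2 - 2 * nu)))) by ring.
apply: le_trans (ler_wpM2l (normr_ge0 _) H).
rewrite mulr_sumr innerC linear_sum/=; apply: le_trans (ler_norm_sum _ _ _) _.
apply: ler_sum => i _; rewrite innerZr normrM ger0_norm ?binom_coef_ge0 //.
rewrite innerC (landweber_sym k adjFG) [leRHS]mulrCA ler_wpM2l ?binom_coef_ge0 //.
exact: cauchy_schwarz.
Qed.

End Source.

(** * Optimality and the degenerate coconvexity exponent *)

Section Optimality.
Context {R : realType} {U V : hilbertType R}.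
Variables (F : {linear U -> V}) (G : {linear V -> U}).
Hypothesis adjFG : forall u v, '[F u, v] = '[u, G v].
Variable J : U -> \bar R.
Hypothesis J_ge0 : forall u, (0 <= J u)%E.

Lemma tikhonov_argmin_le (alpha : R) (v : V) (u u0 : U) (a : R) : 0 < alpha ->
  argmin setT (tikhonov F J alpha v) u -> J u0 = a%:E ->
  exists2 b : R, J u = b%:E &
    2^-1 * `|F u - v| ^+ 2 + alpha * b <= 2^-1 * `|F u0 - v| ^+ 2 + alpha * a.
Proof.
move=> al0 [_ umin] Ju0; have := umin u0 I; rewrite /tikhonov Ju0.
case: (J u) (J_ge0 u) => [b||//] _; first by rewrite -!EFinM -!EFinD lee_fin => ?; exists b.
by rewrite gt0_muley ?lte_fin // addey // -EFinM -EFinD leye_eq.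
Qed.

(** Along the segment from [u] to [w] the penalty is bounded by its chord and
the data term is quadratic, so the one-sided slope at [u] is nonnegative. *)
Lemma tikhonov_optimality (alpha : R) (v : V) (u u0 : U) : convex_functional J ->
  0 < alpha -> (J u0 < +oo)%E -> argmin setT (tikhonov F J alpha v) u ->
  subdifferential J u (alpha^-1 *: G (v - F u)).
Proof.
move=> Jc al0; case Ju0 : (J u0) (J_ge0 u0) => [a0||//] _ // _ umin.
have [a Ja _] := tikhonov_argmin_le al0 umin Ju0.
split=> [|w]; first by rewrite Ja ltry.
case Jw : (J w) (J_ge0 w) => [b||//] _; last by rewrite leey.
rewrite Ja -EFinD lee_fin innerZl innerC -adjFG.
suff : 0 <= '[F u - v, F (w - u)] + alpha * (b - a).
  have -> : '[F (w - u), v - F u] = - '[F u - v, F (w - u)].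
    by rewrite innerC -[v - F u]opprB innerNl.
  move=> H; rewrite -(ler_pM2l al0) mulrDr mulrA divff ?gt_eqF // mul1r; lra.
apply: (@slope_ge0 _ _ (2^-1 * `|F (w - u)| ^+ 2)) => t t0 t1.
set x := t *: w + (1 - t) *: u.
have Jx : (J x <= (t * b + (1 - t) * a)%:E)%E.
  by rewrite EFinD !EFinM -Jw -Ja; apply: Jc; rewrite ltW.
case Jx' : (J x) (J_ge0 x) Jx => [c||//] _; rewrite ?leye_eq // lee_fin => cle.
have [a' ] := tikhonov_argmin_le al0 umin Jx'.
rewrite Ja => -[<-].
have -> : F x - v = (F u - v) + t *: F (w - u).
  have -> : x = u + t *: (w - u).
    by rewrite /x scalerBl scale1r scalerBr addrCA.
  have -> : F (u + t *: (w - u)) = F u + t *: F (w - u) by rewrite linearD linearZ.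
  by rewrite addrAC.
rewrite (normD_sqr (F u - v)) normZ_sqr innerZr => H.
have := ler_wpM2l (ltW al0) cle.
lra.
Qed.

End Optimality.

Section Coconvex.
Context {R : realType} {U : hilbertType R}.
Variable J : U -> \bar R.
Hypothesis J_ge0 : forall u, (0 <= J u)%E.
Hypothesis J_convex : convex_functional J.
Hypothesis J_lsc : lower_semicontinuous J.

Lemma subdifferential_monotone (u1 u2 xi1 xi2 : U) :
  subdifferential J u1 xi1 -> subdifferential J u2 xi2 ->
  0 <= '[xi1 - xi2, u1 - u2].
Proof.
move=> [J1 /(_ u2) H1] [J2 /(_ u1) H2]; move: H1 H2 J1 J2.
case: (J u1) (J_ge0 u1) => [a||//] _ //; case: (J u2) (J_ge0 u2) => [b||//] _ //.
rewrite -!EFinD !lee_fin => + + _ _.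
rewrite -[u2 - u1]opprB innerNr innerBl; lra.
Qed.

Lemma lsc_addEFin (f : U -> R) :
  continuous f -> lower_semicontinuous (fun x => ((f x)%:E + J x)%E).
Proof.
move=> fc x a afJ.
have [a1 [a2 [a1f a2J aa]]] : exists a1 a2 : R,
    [/\ a1 < f x, (a2%:E < J x)%E & a <= a1 + a2].
  case E : (J x) (J_ge0 x) afJ => [r||//] _.
    rewrite -EFinD lte_fin => afr.
    by exists (f x - (f x + r - a) / 2), (r - (f x + r - a) / 2); rewrite lte_fin; split; lra.
  by exists (f x - 1), (a - f x + 1); split; rewrite ?ltry //; lra.
have [W nW WJ] := J_lsc a2J.
exists (W `&` [set y | a1 < f y]).
  by apply: filterI => //; exact: (cvgr_gt _ (fc x)).
move=> y [/WJ + /=]; case: (J y) (J_ge0 y) => [r||//] _; last by rewrite addey ?ltry.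
by rewrite -EFinD !lte_fin; lra.
Qed.

(** Proximal points minimise the Tikhonov functional of the identity with
[alpha = 1]. *)
Lemma prox_exists (z u0 : U) : (J u0 < +oo)%E ->
  exists u, subdifferential J u (z - u).
Proof.
move=> Ju0.
have [u umin] : exists u, forall x, (tikhonov idfun J 1 z u <= tikhonov idfun J 1 z x)%E.
  apply: (@strongly_convex_min _ _ _ 8^-1 0 u0).
  - rewrite /tikhonov; under eq_fun do rewrite mul1e.
    apply: lsc_addEFin => x; apply: cvgM; first exact: cvg_cst.
    have c : `|y - z| @[y --> x] --> `|x - z|.
      by apply: cvg_norm; apply: cvgB; [exact: cvg_id|exact: cvg_cst].
    by rewrite expr2; under eq_fun do rewrite expr2; exact: cvgM.
  - by rewrite invr_gt0.
  - move=> x y r s; rewrite /tikhonov !mul1e /=.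
    case Ex : (J x) (J_ge0 x) => [a||//] _; last by rewrite addey // leye_eq.
    case Ey : (J y) (J_ge0 y) => [b||//] _; last by rewrite addey // leye_eq.
    rewrite -!EFinD !lee_fin => xr ys.
    have h01 : 0 <= (2^-1 : R) <= 1 by apply/andP; split; lra.
    have := J_convex x y h01.
    have -> : 1 - 2^-1 = 2^-1 :> R by lra.
    rewrite -scalerDr Ex Ey -!EFinM -EFinD.
    case: (J _) (J_ge0 (2^-1 *: (x + y))) => [c||//] _; last by rewrite leye_eq.
    rewrite -EFinD !lee_fin => cab.
    have E1 : `|2^-1 *: (x + y) - z| ^+ 2 = 4^-1 * `|(x - z) + (y - z)| ^+ 2.
      have -> : 2^-1 *: (x + y) - z = 2^-1 *: ((x - z) + (y - z)).
        have zE : 2^-1 *: (z + z) = z.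
          by rewrite scalerDr -scalerDl (_ : 2^-1 + 2^-1 = 1 :> R) ?scale1r //; lra.
        by rewrite addrACA -opprD scalerBr zE.
      by rewrite normZ_sqr; lra.
    have E2 : `|x - y| ^+ 2 = `|(x - z) - (y - z)| ^+ 2.
      by rewrite opprB addrA subrK.
    rewrite E1 E2 (normD_sqr (x - z)) (normB_sqr (x - z) (y - z)); lra.
  - move=> x; rewrite /tikhonov mul1e; apply: adde_ge0 => //.
  - by rewrite /tikhonov mul1e; apply: lte_add_pinfty => //; exact: ltry.
exists u; have := @tikhonov_optimality R U U idfun idfun _ J J_ge0 1 z u u0.
rewrite invr1 scale1r; apply => //.
Qed.

(** Let [w] be the proximal point of [u + xi + d], with subgradient [xi'].  Then
[w] is within [`|d|] of [u], whereas 1-coconvexity keeps points with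
distinct subgradients at distance at least [C].  So [xi' = xi], which says
[w = u + d]. *)
Lemma coconvex1_step (rho : R) : 0 < rho -> locally_coconvex 1 J ->
  exists2 C : R, 0 < C & forall u d xi : U, `|u| + `|d| <= rho -> `|d| < C ->
    subdifferential J u xi -> subdifferential J (u + d) xi.
Proof.
move=> rho0 /(_ rho rho0) [C C0 HC]; exists C => // u d xi ud dC uxi.
have [Ju _] := uxi.
have [w wz] := prox_exists (u + xi + d) Ju.
set xi' := u + xi + d - w in wz.
have xiE : xi' - xi = d - (w - u).
  by rewrite /xi' opprB addrAC [u + xi + d]addrAC addrK addrAC addrC addrA.
have wu : `|w - u| <= `|d|.
  have [->|wu0] := eqVneq (w - u) 0; first by rewrite normr0.
  have nwu : 0 < `|w - u| by rewrite normr_gt0.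
  rewrite -(ler_pM2r nwu) -expr2; apply: le_trans (inner_le _ _).
  have := subdifferential_monotone wz uxi; rewrite xiE innerBl innerxx; lra.
have w_rho : `|w| <= rho.
  rewrite -[w](subrK u) (le_trans (ler_normD _ _)) // (le_trans _ ud) // addrC lerD2l //.
have u_rho : `|u| <= rho by apply: le_trans ud; rewrite lerDl.
have := HC w u xi' xi _ _ w_rho u_rho wz uxi.
have dw : dom_subdifferential J w by exists xi'.
have du : dom_subdifferential J u by exists xi.
move=> /(_ dw du); rewrite powRr1 // => H.
have xx : xi' = xi.
  apply/eqP; rewrite -subr_eq0 -normr_eq0; apply/negP => /negP n0.
  have {}n0 : 0 < `|xi' - xi| by rewrite lt_neqAle eq_sym n0 normr_ge0.
  have := le_trans H (inner_le _ _); rewrite mulrC ler_pM2l // => CW.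
  by have := le_lt_trans (le_trans CW wu) dC; rewrite ltxx.
have -> : u + d = w; last by rewrite -xx.
move/eqP: xiE; rewrite xx subrr eq_sym subr_eq0 => /eqP ->.
by rewrite addrC subrK.
Qed.

(** Finitely many small steps carry the subgradient [xi] from [u] to any other
point, so the functional is affine; a nonzero vector would give a ray along
which it does not increase, against coercivity. *)
Lemma coconvex1_trivial (u xi : U) : locally_coconvex 1 J -> coercive J ->
  subdifferential J u xi -> forall x : U, x = 0.
Proof.
move=> J1 Jco uxi.
have everywhere h : subdifferential J (u + h) xi.
  pose rho := `|u| + 2 * `|h| + 1.
  have rho0 : 0 < rho by rewrite ltr_wpDl // addr_ge0 // mulr_ge0.
  have [C C0 HC] := coconvex1_step rho0 J1.
  have [N HN] : exists N : nat, `|h| / C < N%:R.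
    by exists (Num.bound (`|h| / C)); apply: archi_boundP; rewrite divr_ge0 // ltW.
  have N0 : 0 < N%:R :> R by apply: le_lt_trans HN; rewrite divr_ge0 // ltW.
  have N1 : 1 <= N%:R :> R by rewrite ler1n -(ltr0n R).
  have dE : `|N%:R^-1 *: h| = `|h| / N%:R.
    by rewrite normrZ gtr0_norm ?invr_gt0 // mulrC.
  have claim j : (j <= N)%N -> subdifferential J (u + (j%:R / N%:R) *: h) xi.
    elim: j => [|j IH] jN; first by rewrite mul0r scale0r addr0.
    have -> : u + (j.+1%:R / N%:R) *: h = u + (j%:R / N%:R) *: h + N%:R^-1 *: h.
      by rewrite -addrA -scalerDl -natr1 mulrDl mul1r.
    apply: HC; last by apply: IH; exact: ltnW.
      rewrite dE.
      have nj : `|(j%:R / N%:R) *: h| <= `|h|.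
        rewrite normrZ ger0_norm ?divr_ge0 // ler_piMl //.
        by rewrite ler_pdivrMr // mul1r ler_nat ltnW.
      have hN : `|h| / N%:R <= `|h| by rewrite ler_pdivrMr // ler_peMr.
      have := ler_normD u ((j%:R / N%:R) *: h); rewrite /rho; lra.
    by rewrite dE ltr_pdivrMr // mulrC -ltr_pdivrMr.
  by have := claim N (leqnn N); rewrite divff ?gt_eqF // scale1r.
have [Ju _] := uxi.
case Eu : (J u) (J_ge0 u) Ju => [a||//] _ // _.
have [r Hr] := Jco (a + 1).
move=> x; apply/eqP; apply: contrapT => /negP x0.
have {x0} [e e0 xie] : exists2 e : U, e != 0 & '[xi, e] <= 0.
  have [?|/ltW xi0] := leP '[xi, x] 0; first by exists x.
  by exists (- x); rewrite ?oppr_eq0 // innerNr oppr_le0.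
have ne : 0 < `|e| by rewrite normr_gt0.
pose s := (`|r| + `|u|) / `|e|.
have s0 : 0 <= s by rewrite divr_ge0 // addr_ge0.
have [_ /(_ u)] := everywhere (s *: e).
have /Hr : r <= `|u + s *: e|.
  have := ler_normB (u + s *: e) u; rewrite addrAC subrr add0r normrZ ger0_norm //.
  rewrite /s divfK ?gt_eqF // => ?; have := ler_norm r; lra.
case: (J (u + s *: e)) => [b||//]; rewrite ?leye_eq // ?Eu; last first.
  by move=> _ /eqP.
rewrite -EFinD !lee_fin opprD addNKr innerNr innerZr => ab bx.
have : s * '[xi, e] <= 0 by rewrite mulr_ge0_le0.
lra.
Qed.

End Coconvex.

(** * The convergence rate *)

Section Rate.
Context {R : realType}.

(** Either [A] or the sublinear term makes up at least half of [E]. *)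
Lemma le_powR_absorb (E A B s : R) : 0 < s -> 0 <= A -> 0 <= B -> 0 < E ->
  E <= A + B * E `^ (1 - s) -> E <= 2 * A + (2 * B) `^ s^-1.
Proof.
move=> s0 A0 B0 E0 H.
have P0 : 0 <= (2 * B) `^ s^-1 by exact: powR_ge0.
have [|AE] := leP E (2 * A); first by lra.
have H2 : E <= 2 * B * E `^ (1 - s) by lra.
have EE : E = E `^ s * E `^ (1 - s).
  by rewrite -powRD ?(gt_eqF E0) ?implybT // addrC subrK powRr1 // ltW.
rewrite {1}EE ler_pM2r ?powR_gt0 // in H2.
have si0 : 0 <= s^-1 by rewrite invr_ge0 ltW.
have := ge0_ler_powR si0 _ _ H2.
rewrite !nnegrE powR_ge0 mulr_ge0 // -powRrM divff ?gt_eqF // powRr1 ?(ltW E0) //.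
by move=> /(_ isT isT); lra.
Qed.

(** Read [y] as [`|p - pdag|].  Both [D] and [al * y ^+ 2] are at most their
sum [E], and the exponents of [al * y ^+ 2] and [D] in the last term add up
to [1 - s] for [s = nu - (2 * nu - 1) / q]. *)
Lemma rate_absorb (q nu al de y D K : R) : 1 < q -> 2^-1 < nu -> nu <= 1 ->
  0 < al -> 0 < D -> 0 <= y -> 0 <= K ->
  D + al * y ^+ 2 <= D / 4 + de * y +
    K * (al * (y `^ (2 - 2 * nu) * (D `^ q^-1) `^ (2 * nu - 1))) ->
  D <= 4 * (de ^+ 2 / al) +
    (4 * K) `^ (nu - (2 * nu - 1) / q)^-1 * al `^ (q * nu / (1 + nu * q - 2 * nu)).
Proof.
move=> q1 nu0 nu1 al0 D0 y0 K0.
have q0 : 0 < q by lra.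
set s := nu - (2 * nu - 1) / q.
have q'1 : q^-1 <= 1 by rewrite invf_le1 // ltW.
have q'0 : 0 < q^-1 by rewrite invr_gt0.
have den0 : 0 < 1 + nu * q - 2 * nu.
  have : 0 < nu * (q - 1) by rewrite mulr_gt0 // ?subr_gt0 //; lra.
  lra.
have sE : s = (1 + nu * q - 2 * nu) / q by rewrite /s; field; rewrite gt_eqF.
have s0 : 0 < s by rewrite sE divr_gt0.
have nus : nu * s^-1 = q * nu / (1 + nu * q - 2 * nu).
  by rewrite sE; field; rewrite !gt_eqF.
pose E := D + al * y ^+ 2.
have ay0 : 0 <= al * y ^+ 2 by rewrite mulr_ge0 ?sqr_ge0 // ltW.
have E0 : 0 < E by rewrite ltr_wpDr.
have young : de * y <= de ^+ 2 / al + al * y ^+ 2 / 4.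
  have : 0 <= (2 * de - al * y) ^+ 2 / (4 * al) by rewrite divr_ge0 ?sqr_ge0 // mulr_ge0 // ltW.
  have -> : (2 * de - al * y) ^+ 2 / (4 * al) = de ^+ 2 / al - de * y + al * y ^+ 2 / 4.
    by field; rewrite gt_eqF.
  lra.
have key : al * (y `^ (2 - 2 * nu) * (D `^ q^-1) `^ (2 * nu - 1)) <= al `^ nu * E `^ (1 - s).
  have -> : al * (y `^ (2 - 2 * nu) * (D `^ q^-1) `^ (2 * nu - 1)) =
      al `^ nu * ((al * y ^+ 2) `^ (1 - nu) * D `^ (q^-1 * (2 * nu - 1))).
    rewrite powRM ?sqr_ge0 ?(ltW al0) // -powR_mulrn // -!powRrM !mulrA -powRD ?(gt_eqF al0) ?implybT //.
    have -> : nu + (1 - nu) = 1 by ring.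
    by rewrite powRr1 ?(ltW al0) //; congr (_ * _ `^ _ * _); ring.
  rewrite ler_wpM2l ?powR_ge0 //.
  have -> : 1 - s = (1 - nu) + q^-1 * (2 * nu - 1) by rewrite /s; lra.
  rewrite [leRHS]powRD ?(gt_eqF E0) ?implybT //.
  apply: ler_pM; rewrite ?powR_ge0 //; apply: ge0_ler_powR; rewrite ?nnegrE ?(ltW E0) ?(ltW D0) //.
  - by rewrite subr_ge0.
  - by rewrite /E lerDr ltW.
  - by rewrite mulr_ge0 ?(ltW q'0) //; lra.
  - by rewrite /E lerDl.
move=> H.
have := ler_wpM2l K0 key => KE.
have d0 : 0 <= de ^+ 2 / al by rewrite divr_ge0 ?sqr_ge0 // ltW.
have : E <= 2 * (de ^+ 2 / al) + 2 * (K * al `^ nu) * E `^ (1 - s).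
  rewrite /E in KE *; lra.
have A0 : 0 <= 2 * (de ^+ 2 / al) by rewrite mulr_ge0.
have B0 : 0 <= 2 * (K * al `^ nu) by rewrite !mulr_ge0 ?powR_ge0.
move/(le_powR_absorb s0 A0 B0 E0).
have -> : 2 * (2 * (K * al `^ nu)) = (4 * K) * al `^ nu by ring.
rewrite powRM ?powR_ge0 ?mulr_ge0 // -powRrM nus.
by rewrite /E; lra.
Qed.

End Rate.

Section Tikhonov.
Context {R : realType} {U V : hilbertType R}.
Variables (F : {linear U -> V}) (G : {linear V -> U}).
Hypothesis F_cont : continuous F.
Hypothesis adjFG : forall u v, '[F u, v] = '[u, G v].
Variable J : U -> \bar R.
Hypothesis J_ge0 : forall u, (0 <= J u)%E.
Hypothesis J_convex : convex_functional J.
Hypothesis J_coercive : coercive J.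
Variable udag : U.

(** Comparison with [udag] bounds the penalty of the minimisers, hence their
norm; this is what makes a local coconvexity constant sufficient. *)
Lemma tikhonov_argmin_bounded (M a : R) : J udag = a%:E ->
  exists2 rho : R, 0 < rho & forall (de al : R) (v : V) (u : U),
    0 < al -> de ^+ 2 / al <= M -> `|v - F udag| <= de ->
    argmin setT (tikhonov F J al v) u -> `|u| <= rho.
Proof.
move=> Ja; have [r Hr] := J_coercive (a + M + 1).
exists (`|r| + 1); first by rewrite ltr_wpDl.
move=> de al v u al0 dM vd umin.
rewrite leNgt; apply/negP => ru.
have {}/Hr : r <= `|u| by have := ler_norm r; lra.
have [b -> ] := tikhonov_argmin_le J_ge0 al0 umin Ja.
rewrite lee_fin => H abM.
have de0 : 0 <= de by exact: le_trans vd.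
have : `|F udag - v| ^+ 2 <= de ^+ 2 by rewrite distrC ler_pXn2r ?nnegrE.
rewrite ler_pdivrMr // in dM.
have := sqr_ge0 `|F u - v|.
have M0 : 0 <= M * al by apply: le_trans dM; exact: sqr_ge0.
have := ler_wpM2l (ltW al0) abM.
nra.
Qed.

(** The rate for [q > 1], where the exponent of [alpha] has a positive
denominator. *)
Lemma bregman_rate (q nu : R) (eta xi : U) : 1 < q -> locally_coconvex q J ->
  2^-1 < nu -> nu <= 1 -> xi = op_powR (G \o F) nu eta ->
  subdifferential J udag xi ->
  forall M : R, exists C1 C2 : R, [/\ 0 < C1, 0 < C2 &
    forall (de al : R) (v : V) (u : U), 0 < al -> de ^+ 2 / al <= M ->
      `|v - F udag| <= de -> argmin setT (tikhonov F J al v) u ->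
      sym_bregman (al^-1 *: G (v - F u)) xi u udag <=
        C1 * (de ^+ 2 / al) + C2 * al `^ (q * nu / (1 + nu * q - 2 * nu))].
Proof.
move=> q1 Jco nu0 nu1 xiE xidag M.
have [k k0 Fk] := continuous_linear_le F_cont.
have [c c0 Hc] := source_interpolation adjFG k0 Fk eta nu0 nu1.
have [Jdag _] := xidag.
case Ja : (J udag) (J_ge0 udag) Jdag => [a||//] _ // _.
have [r r0 Hr] := tikhonov_argmin_bounded M Ja.
have rho0 : 0 < r + `|udag| by rewrite ltr_pwDl.
have [C C0 HC] := Jco _ rho0.
have q0 : 0 < q by lra.
have Cq0 : 0 < (C^-1) `^ q^-1 by rewrite powR_gt0 // invr_gt0.
pose K := c * (2 * (C^-1) `^ q^-1) `^ (2 * nu - 1).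
have K0 : 0 <= K by rewrite mulr_ge0 ?powR_ge0 // ltW.
exists 4, ((4 * K) `^ (nu - (2 * nu - 1) / q)^-1 + 1); split=> //.
  by rewrite ltr_wpDl ?powR_ge0.
move=> de al v u al0 dM vd umin; rewrite /sym_bregman.
have de0 : 0 <= de by exact: le_trans vd.
have ur := Hr _ _ _ _ al0 dM vd umin.
pose p := al^-1 *: (v - F u).
have pE : al^-1 *: G (v - F u) = G p by rewrite /p linearZ.
have Ju : (J udag < +oo)%E by rewrite Ja ltry.
have := tikhonov_optimality adjFG J_ge0 J_convex al0 Ju umin.
rewrite pE => uxi.
set D := '[G p - xi, u - udag].
have coD : C * `|G p - xi| `^ q <= D.
  have u_rho : `|u| <= r + `|udag| by apply: le_trans ur _; rewrite lerDl.
  have udag_rho : `|udag| <= r + `|udag| by rewrite lerDr ltW.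
  have du : dom_subdifferential J u by exists (G p).
  have dudag : dom_subdifferential J udag by exists xi.
  exact: HC.
have D0 : 0 <= D by apply: le_trans coD; rewrite mulr_ge0 ?powR_ge0 // ltW.
have d0 : 0 <= de ^+ 2 / al by rewrite divr_ge0 ?sqr_ge0 // ltW.
rewrite le_eqVlt in D0; case/predU1P : D0 => [<-|D0].
  apply: addr_ge0; first exact: mulr_ge0.
  by apply: mulr_ge0; rewrite ?powR_ge0 // addr_ge0 ?powR_ge0.
have Dq0 : 0 < D `^ q^-1 by rewrite powR_gt0.
have nz : `|G p - xi| <= (C^-1) `^ q^-1 * D `^ q^-1.
  have q'0 : 0 <= q^-1 by rewrite invr_ge0 ltW.
  rewrite -ler_pdivlMl // in coD.
  have := ge0_ler_powR q'0 _ _ coD.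
  rewrite !nnegrE powR_ge0 mulr_ge0 ?invr_ge0 ?(ltW C0) ?(ltW D0) //.
  rewrite -powRrM divff ?gt_eqF // powRr1 // powRM ?invr_ge0 ?(ltW C0) ?(ltW D0) //.
  exact.
(* Small enough for [xidag] and [G (F h)] to be interchangeable below, at the
   cost of [D / 4] and of a factor 2. *)
pose e := Num.min (D / 4 / (`|u - udag| + 1)) ((C^-1) `^ q^-1 * D `^ q^-1).
have e0 : 0 < e.
  rewrite lt_min; apply/andP; split; last exact: mulr_gt0.
  by rewrite !divr_gt0 // ltr_wpDl.
have [h hxi hw] := Hc e e0; rewrite -xiE in hxi.
pose w := p - F h.
have GwE : G w = G p - G (F h) by rewrite /w linearB.
have Gw : `|G w| <= 2 * (C^-1) `^ q^-1 * D `^ q^-1.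
  have -> : G w = (G p - xi) - (G (F h) - xi) by rewrite GwE opprB addrA subrK.
  apply: le_trans (ler_normB _ _) _.
  have : e <= (C^-1) `^ q^-1 * D `^ q^-1 by rewrite ge_min lexx orbT.
  lra.
have De : '[G (F h) - xi, u - udag] <= D / 4.
  apply: le_trans (inner_le _ _) _.
  have n1 : 0 < `|u - udag| + 1 by rewrite ltr_wpDl.
  apply: (@le_trans _ _ (e * (`|u - udag| + 1))).
    by apply: ler_pM => //; rewrite lerDl.
  by rewrite -ler_pdivlMr // ge_min lexx.
have DE : D = '[w, F (u - udag)] + '[G (F h) - xi, u - udag].
  by rewrite innerC adjFG innerC -innerDl GwE addrA subrK.
have FE : F (u - udag) = (v - F udag) - al *: (w + F h).
  by rewrite /w subrK /p scalerA divff ?gt_eqF // scale1r linearB opprB [RHS]addrC addrA subrK.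
have H1 : '[w, v - F udag] <= de * `|w|.
  by apply: le_trans (inner_le _ _) _; rewrite mulrC ler_wpM2r.
have H2 : - '[w, F h] <= K * (`|w| `^ (2 - 2 * nu) * (D `^ q^-1) `^ (2 * nu - 1)).
  apply: le_trans (ler_norm _) _; rewrite normrN innerC; apply: le_trans (hw w) _.
  rewrite /K -mulrA ler_wpM2l ?(ltW c0) // mulrCA ler_wpM2l ?powR_ge0 //.
  rewrite -powRM ?mulr_ge0 ?(ltW Cq0) ?(ltW Dq0) //.
  by apply: ge0_ler_powR Gw; rewrite ?nnegrE ?mulr_ge0 ?(ltW Cq0) ?(ltW Dq0) //; lra.
have : D + al * `|w| ^+ 2 <= D / 4 + de * `|w| +
    K * (al * (`|w| `^ (2 - 2 * nu) * (D `^ q^-1) `^ (2 * nu - 1))).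
  have H3 := ler_wpM2l (ltW al0) H2.
  by rewrite FE innerBr innerZr (innerDr w w) innerxx in DE; lra.
move/(rate_absorb q1 nu0 nu1 al0 D0 (normr_ge0 _) K0) => /le_trans; apply.
by rewrite lerD2l ler_wpM2r ?powR_ge0 // lerDl.
Qed.

End Tikhonov.

Theorem theorem14 (R : realType) (U V : hilbertType R)
    (F : {linear U -> V}) (F_cont : continuous F)
    (J : U -> \bar R) (J_ge0 : forall u, (0 <= J u)%E)
    (J_convex : convex_functional J) (J_lsc : lower_semicontinuous J)
    (J_coercive : coercive J)
    (vdag : V) (udag : U) (udag_min : argmin [set u | F u = vdag] J udag)
    (q : R) (q_ge1 : 1 <= q) (J_coconvex : locally_coconvex q J)
    (nu : R) (nu_gt : 2^-1 < nu) (nu_le1 : nu <= 1)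
    (etadag xidag : U)
    (xidag_def : xidag = op_powR (adjoint F \o F) nu etadag)
    (xidag_sub : subdifferential J udag xidag) :
  [/\ forall (alpha : R) (v : V) (u : U), 0 < alpha ->
        argmin setT (tikhonov F J alpha v) u ->
        subdifferential J u (tikhonov_subgradient F alpha v u),
      forall M : R, 0 < M ->
        exists C1 C2 : R, [/\ 0 < C1, 0 < C2 &
          forall (delta alpha : R) (v : V) (u : U),
            0 < delta -> 0 < alpha -> delta ^+ 2 / alpha <= M ->
            `|v - vdag| <= delta ->
            argmin setT (tikhonov F J alpha v) u ->
            sym_bregman (tikhonov_subgradient F alpha v u) xidag u udag
              <= C1 * (delta ^+ 2 / alpha)
                 + C2 * alpha `^ (q * nu / (1 + nu * q - 2 * nu))] &
      let a := (2 + 2 * nu * q - 4 * nu) / (1 + 2 * nu * q - 2 * nu) in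
      forall c c' : R, 0 < c -> c <= c' ->
        exists delta0 C : R, [/\ 0 < delta0, 0 < C &
          forall (delta alpha : R) (v : V) (u : U),
            0 < delta -> delta <= delta0 ->
            c * delta `^ a <= alpha -> alpha <= c' * delta `^ a ->
            `|v - vdag| <= delta ->
            argmin setT (tikhonov F J alpha v) u ->
            sym_bregman (tikhonov_subgradient F alpha v u) xidag u udag
              <= C * delta `^ (2 * nu * q / (1 + 2 * nu * q - 2 * nu))]].
Proof.
have [G GE adjFG] := adjoint_exists F_cont.
have [Fudag _] := udag_min; rewrite /= in Fudag.
have [Jdag _] := xidag_sub.
have optimality (alpha : R) (v : V) (u : U) : 0 < alpha ->
    argmin setT (tikhonov F J alpha v) u ->
    subdifferential J u (tikhonov_subgradient F alpha v u).
  move=> al0 umin; rewrite /tikhonov_subgradient GE.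
  exact: (tikhonov_optimality adjFG J_ge0 J_convex al0 Jdag umin).
have [q1|q_le1] := ltP 1 q; last first.
  have q1 : q = 1 by apply/le_anti; rewrite q_le1.
  rewrite q1 in J_coconvex.
  have U0 := coconvex1_trivial J_ge0 J_convex J_lsc J_coconvex J_coercive xidag_sub.
  have D0 (alpha : R) (v : V) (u : U) :
      sym_bregman (tikhonov_subgradient F alpha v u) xidag u udag = 0.
    by rewrite /sym_bregman (U0 (u - udag)) inner0r.
  split=> // [M _|a c c' _ _]; exists 1, 1; split=> // delta alpha v u.
    move=> _ al0 _ _ _; rewrite D0 !mul1r.
    by rewrite addr_ge0 ?powR_ge0 // divr_ge0 ?sqr_ge0 // ltW.
  by rewrite D0 mul1r powR_ge0.
have rate (M : R) : exists C1 C2 : R, [/\ 0 < C1, 0 < C2 &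
    forall (delta alpha : R) (v : V) (u : U),
      0 < alpha -> delta ^+ 2 / alpha <= M -> `|v - vdag| <= delta ->
      argmin setT (tikhonov F J alpha v) u ->
      sym_bregman (tikhonov_subgradient F alpha v u) xidag u udag
        <= C1 * (delta ^+ 2 / alpha)
           + C2 * alpha `^ (q * nu / (1 + nu * q - 2 * nu))].
  rewrite -Fudag /tikhonov_subgradient GE.
  apply: (bregman_rate F_cont adjFG J_ge0 J_convex J_coercive q1 J_coconvex
    nu_gt nu_le1 _ xidag_sub).
  by rewrite xidag_def GE.
split=> //.
  move=> M _; have [C1 [C2 [C10 C20 H]]] := rate M.
  by exists C1, C2; split=> // delta alpha v u _; exact: H.
move=> a c c' c0 cc'.
pose b := 2 * nu * q / (1 + 2 * nu * q - 2 * nu).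
pose p := q * nu / (1 + nu * q - 2 * nu).
have nuq : nu <= nu * q by rewrite ler_peMr //; lra.
have den0 : 0 < 1 + 2 * nu * q - 2 * nu by lra.
have den1 : 0 < 1 + nu * q - 2 * nu.
  have : 0 < nu * (q - 1) by rewrite mulr_gt0 ?subr_gt0 //; lra.
  lra.
(* The choice of [a] balances the two terms: both become [delta `^ b]. *)
have aE : 2 - a = b by rewrite /a /b; field; rewrite gt_eqF.
have apE : a * p = b by rewrite /a /b /p; field; rewrite !gt_eqF.
have b0 : 0 <= b by rewrite divr_ge0 // ltW //; lra.
have p0 : 0 <= p by rewrite divr_ge0 ?(ltW den1) // mulr_ge0 //; lra.
have c'0 : 0 < c' by exact: lt_le_trans cc'.
have [C1 [C2 [C10 C20 H]]] := rate c^-1.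
exists 1, (C1 / c + C2 * c' `^ p); split=> //.
  by rewrite addr_gt0 ?mulr_gt0 ?powR_gt0 // invr_gt0.
move=> delta alpha v u d0 d1 alc alc' vd umin.
have da0 : 0 < delta `^ a by rewrite powR_gt0.
have al0 : 0 < alpha by apply: lt_le_trans alc; rewrite mulr_gt0.
have d2E : delta ^+ 2 = delta `^ b * delta `^ a.
  by rewrite -powRD ?(gt_eqF d0) ?implybT // -aE subrK powR_mulrn // ltW.
have dal : delta ^+ 2 / alpha <= c^-1 * delta `^ b.
  rewrite ler_pdivrMr // d2E mulrAC [leRHS]mulrC ler_wpM2l ?powR_ge0 //.
  by rewrite mulrC ler_pdivlMr // mulrC.
have db1 : delta `^ b <= 1.
  by rewrite -[leRHS](powRr0 delta) ger_powR // d0.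
have dM : delta ^+ 2 / alpha <= c^-1.
  by apply: le_trans dal _; rewrite ler_piMr // invr_ge0 ltW.
apply: le_trans (H _ _ _ _ al0 dM vd umin) _.
rewrite [leRHS]mulrDl; apply: lerD.
  by rewrite -mulrA ler_wpM2l // ltW.
rewrite -[leRHS]mulrA ler_wpM2l ?(ltW C20) // -/p -/b -apE powRrM.
rewrite -powRM ?(ltW c'0) ?(ltW da0) //.
apply: ge0_ler_powR => //; rewrite ?nnegrE ?(ltW al0) // mulr_ge0 ?(ltW c'0) //.
exact: ltW.
Qed.
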